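(* Let $(A_n)_{n\ge 0}$ and $(Q_n)_{n\ge 0}$ be sequences of algebras over an integral domain $R$ satisfying axioms (1)–(12) listed in the context (with branching diagram $\Gamma$). Let $K$ be a field that is an $R$-module. Let $n_0$ be the smallest value of $n$ such that the trace $\mathrm{tr}$ on $A_n^K$ is degenerate, with $n_0=\infty$ if $\mathrm{tr}$ is non-degenerate on $A_n^K$ for all $n$. Let $n_1+1$ be the smallest value of $n$ such that $Q_n^K$ fails to be semisimple, with $n_1=\infty$ if $Q_n^K$ is semisimple for all $n$. Then $A_n^K$ is semisimple if and only if $n\le m=\min\{n_0,n_1\}$.
   Context: **Branching diagrams.** A (multiplicity-free) abstract branching diagram $\Gamma$ is a graph with vertex set $\coprod_{i\ge 0}\Gamma_i$ such that $\Gamma_0$ is a singleton and every $\Gamma_i$ is finite; vertices $v\in\Gamma_i$, $w\in\Gamma_j$ are adjacent only if $|i-j|=1$, and adjacent vertices are joined by a unique edge; every $v\in\Gamma_i$ with $i\ge1$ is adjacent to at least one vertex of $\Gamma_{i-1}$. Write $|v|=i$ if $v\in\Gamma_i$, and $v\nearrow w$ if $v\in\Gamma_i$ is adjacent to $w\in\Gamma_{i+1}$. The diagram $\tilde\Gamma$ obtained from $\Gamma$ by reflections has level-$n$ vertices $\tilde\Gamma_n=\{(v,n): v\in\Gamma_k,\ k\le n,\ n-k \text{ even}\}$, and $(v,n)\nearrow(w,n+1)$ iff either $|w|=|v|+1$ and $v\nearrow w$ in $\Gamma$, or $|w|=|v|-1$ and $w\nearrow v$ in $\Gamma$. For a sequence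 $B_0\to B_1\to\cdots$ of unital homomorphisms of finite dimensional split semisimple algebras over a field, the branching diagram has as level-$i$ vertices the simple components of $B_i$ (equivalently simple $B_i$-modules), the number of edges between a component of $B_{i+1}$ and one of $B_i$ being the multiplicity of the simple $B_i$-module in the restriction of the simple $B_{i+1}$-module. **Cellular algebras.** An algebra involution is an anti-automorphism $*$ with $(a^* )^*=a$. A unital algebra $A$ over an integral domain $R$ is cellular if it has an algebra involution $*$, a partially ordered set $(\Lambda,\ge)$, a set $\mathcal T(\lambda)$ for each $\lambda\in\Lambda$, and an $R$-basis $\{c^\lambda_{s,t}:\lambda\in\Lambda,\ s,t\in\mathcal T(\lambda)\}$ such that, with $A^{>\lambda}$ (resp. $A^{\ge\lambda}$) the span of the $c^\mu_{s,t}$ with $\mu>\lambda$ (resp. $\mu\ge\lambda$): for $a\in A$, $s\in\mathcal T(\lambda)$ there are $r^s_v(a)\in R$ with $a c^\lambda_{s,t}\equiv\sum_v r^s_v(a)c^\lambda_{v,t}\bmod A^{>\lambda}$ for all $t$; and $(c^\lambda_{s,t})^*\equiv c^\lambda_{t,s}\bmod A^{>\lambda}$. The cell module $\Delta_\lambda$ is the free $R$-module on $\{c^\lambda_s:s\in\mathcal T(\lambda)\}$ with $a c^\lambda_s=\sum_v r^s_v(a)c^\lambda_v$. An order ideal $U\subseteq\Lambda$ is a subset with $\mu\in U,\ \gamma\ge\mu\Rightarrow\gamma\in U$; $A(U)$ is the span of the $c^\lambda_{s,t}$ with $\lambda\in U$ (an ideal). An increasing sequence $(Q_i)$ of cellular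 algebras with the same identity is restriction coherent if for every cell module $\Delta$ of $Q_{i+1}$, the restriction of $\Delta$ to $Q_i$ has a filtration by $Q_i$-submodules whose subquotients are cell modules of $Q_i$. **Setting.** $\Gamma$ is an infinite multiplicity-free branching diagram, each $\Gamma_k$ carrying a partial order $\ge$. Order $\tilde\Gamma_n$ by: $(\gamma,n)\ge(\gamma',n)$ if $|\gamma|<|\gamma'|$, or if $|\gamma|=|\gamma'|=k$ and $\gamma\ge\gamma'$ in $\Gamma_k$. Let $\tilde\Gamma_n^0=\{(\gamma,n)\in\tilde\Gamma_n:|\gamma|<n\}$ (an order ideal). $(A_n)_{n\ge0}$, $(Q_n)_{n\ge0}$ are increasing sequences of unital algebras over an integral domain $R$ with field of fractions $F$. ''A field $K$ that is an $R$-module'' means a field with a ring homomorphism $R\to K$; superscripts denote specialization, $A_n^K=A_n\otimes_RK$, etc. **Axioms.** (1) $A_n$ and $Q_n$ have algebra involutions $*$; those on the $Q_n$ are consistent, i.e. there is an algebra involution on $\bigcup_nQ_n$ with $(Q_n)^*=Q_n$. (2) $A_0=Q_0=R$ and $A_1=Q_1$. (3) $(Q_n)$ is a restriction-coherent tower of cellular algebras, and the partially ordered set in the cell datum of $Q_n$ is $(\Gamma_n,\ge)$. (4) $R$ has characteristic zero. The algebras $Q_n^F$ are split semisimple and the branching diagram of $(Q_n^F)_{n\ge0}$ is $\Gamma$. For any field $K$ that is an $R$-module, either $Q_n^K$ is split semisimple for all $n$, or there is $n_1\ge0$ such that $Q_n^K$ is split semisimple for $n\le n_1$ and non-semisimple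 for $n>n_1$. (5) $A_n$ is cellular with partially ordered set $(\tilde\Gamma_n,\ge)$. (6) For $n\ge1$, $A_{n+1}$ contains an element $e_n$ with $e_n^2=\boldsymbol\delta e_n$, where $\boldsymbol\delta$ is invertible in $R$. The ideal $A_{n+1}e_nA_{n+1}$ coincides with $A_{n+1}(\tilde\Gamma^0_{n+1})$, and $A_{n+1}/(A_{n+1}e_nA_{n+1})\cong Q_{n+1}$. (7) $e_ne_{n\pm1}e_n=e_n$, and $e_ne_m=e_me_n$ if $|n-m|\ge2$. (8) For $n\ge1$, $e_n$ commutes with $A_{n-1}$ and $e_nA_ne_n\subseteq A_{n-1}e_n$. (9) For $n\ge1$, $A_{n+1}e_n=A_ne_n$, and $x\mapsto xe_n$ is injective from $A_n$ to $A_ne_n$. Put $\bar e_n=\boldsymbol\delta^{-1}e_n$. By (8),(9) there is a unique map $E^n_{n-1}:A_n\to A_{n-1}$ with $\bar e_nx\bar e_n=\bar e_nE^n_{n-1}(x)$; it is a unital $A_{n-1}$-$A_{n-1}$-bimodule map (conditional expectation). Define $\mathrm{tr}:\bigcup_nA_n\to R$ by $\mathrm{tr}(1)=1$ and $\mathrm{tr}(x)=\mathrm{tr}(E^n_{n-1}(x))$ for $x\in A_n$. The same definitions apply to, and are compatible with, specializations $A_n^S=A_n\otimes_RS$. (10) $\mathrm{tr}$ is a trace: $\mathrm{tr}(xy)=\mathrm{tr}(yx)$ for $x,y\in A_n$. (11) $\mathrm{tr}$ on $A_n^F$ is non-degenerate for all $n$. (12) Suppose $k<n$ with $n-k$ even,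 $s=(n-k)/2$, and $(\gamma,k)\in\tilde\Gamma_k$. If $x\in A_k^{\ge(\gamma,k)}\setminus A_k^{>(\gamma,k)}$, then $x\,e_{k+1}e_{k+3}\cdots e_{n-1}\in A_n^{\ge(\gamma,n)}\setminus A_n^{>(\gamma,n)}$. A trace $\tau$ on an algebra $A$ is degenerate if there is $0\ne x\in A$ with $\tau(xy)=0$ for all $y\in A$, and non-degenerate (faithful) otherwise. *)

(* Defs.v *)
From HB Require Import structures.
From mathcomp Require Import all_boot all_order all_algebra.
From mathcomp Require Import finmap monalg.

Set Implicit Arguments.
Unset Strict Implicit.
Unset Printing Implicit Defensive.

Import Order.TTheory GRing.Theory.
Local Open Scope ring_scope.

(** * Branching diagrams *)

(* Edges only join consecutive levels and are unique, so a diagram is given by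
   one Boolean relation [bd_up k] (written v ↗ w) for each k. *)
Record branching_diagram (d : Order.disp_t) := BranchingDiagram {
  bd_level :> nat -> finPOrderType d;
  bd_up : forall k, bd_level k -> bd_level k.+1 -> bool;
  bd_root : #|bd_level 0| = 1%N;
  bd_pred : forall k (w : bd_level k.+1), exists v : bd_level k, bd_up v w
}.

Definition infinite_diagram d (G : branching_diagram d) : Prop :=
  ~ exists s : seq {k : nat & G k}, forall v, v \in s.

(* Level n of the diagram obtained by reflections: (v, n) is represented by
   v : {k & G k} with k <= n and n - k even. *)
Definition reflected d (G : branching_diagram d) (n : nat) : Type :=
  {v : {k : nat & G k} | (tag v <= n)%N && ~~ odd (n - tag v)}.

Section ReflectedOrder.
Variables (d : Order.disp_t) (G : branching_diagram d) (n : nat).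

HB.instance Definition _ := Choice.on (reflected G n).

(* A smaller level |v| is higher in the order. *)
Definition reflected_le (x y : reflected G n) : bool :=
  let v := val x in let w := val y in
  (tag w < tag v)%N || (tag v == tag w) && (tagged v <= tagged_as v w)%O.

Lemma reflected_le_refl : reflexive reflected_le.
Proof. by move=> [[i a] pa]; rewrite /reflected_le /= eqxx tagged_asE lexx orbT. Qed.

Lemma reflected_le_anti : antisymmetric reflected_le.
Proof.
move=> [[i a] pa] [[j b] pb]; rewrite /reflected_le /= => le_ab.
apply: val_inj => /=; move: le_ab; rewrite [i == j]eq_sym.
case: ltngtP => //= eq_ij; subst j; rewrite !tagged_asE /=.
by move=> /le_anti ->.
Qed.

Lemma reflected_le_trans : transitive reflected_le.
Proof.
move=> [[j b] pb] [[i a] pa] [[k c] pc]; rewrite /reflected_le /=.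
case/orP=> [lt_ji | /andP[/eqP eq_ij le_ab]].
  case/orP=> [lt_kj | /andP[/eqP eq_jk _]]; last by subst k; rewrite lt_ji.
  by rewrite (ltn_trans lt_kj lt_ji).
subst j; case/orP=> [-> // | /andP[/eqP eq_ik le_bc]].
subst k; rewrite eqxx !tagged_asE /= in le_ab le_bc *.
by rewrite (le_trans le_ab le_bc) orbT.
Qed.

HB.instance Definition _ := Order.Le_isPOrder.Build d (reflected G n)
  reflected_le_refl reflected_le_anti reflected_le_trans.

End ReflectedOrder.

(** * Semisimplicity *)

Definition left_ideal (A : nzRingType) (L : A -> Prop) : Prop :=
  [/\ L 0, forall x y, L x -> L y -> L (x + y) & forall a x, L x -> L (a * x)].

Definition semisimple (A : nzRingType) : Prop :=
  forall L : A -> Prop, left_ideal L ->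
  exists L' : A -> Prop,
    [/\ left_ideal L',
        forall a, exists x y, [/\ L x, L' y & a = x + y]
      & forall x, L x -> L' x -> x = 0].

Section Split.
Variables (K : fieldType) (B : algType K).

(* The representations [rho i] jointly identify B with the product of the
   matrix algebras over the finite index set I; in particular they form a full
   set of simple B-modules. *)
Definition wedderburn_iso (I : finType) (dim : I -> nat)
    (rho : forall i, {lrmorphism B -> 'M[K]_((dim i).+1)}) : Prop :=
  forall M : (forall i, 'M[K]_((dim i).+1)), exists! b, forall i, rho i b = M i.

Definition split_semisimple : Prop :=
  exists (I : finType) (dim : I -> nat)
         (rho : forall i, {lrmorphism B -> 'M[K]_((dim i).+1)}),
    wedderburn_iso rho.

(* The column module of the representation sigma is isomorphic to the direct
   sum over i of [mult i] copies of the column module of [rho i]; the [G i k]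
   are the components of the isomorphism. *)
Definition decomposes_with (m : nat) (sigma : B -> 'M[K]_(m.+1))
    (I : finType) (dim : I -> nat)
    (rho : forall i, {lrmorphism B -> 'M[K]_((dim i).+1)})
    (mult : I -> nat) : Prop :=
  exists G : forall i, 'I_(mult i) -> 'M[K]_((dim i).+1, m.+1),
    (forall i k b, G i k *m sigma b = rho i b *m G i k) /\
    (forall u : (forall i, 'I_(mult i) -> 'cV[K]_((dim i).+1)),
       exists! x : 'cV[K]_(m.+1), forall i k, G i k *m x = u i k).

End Split.

(* The branching diagram of B_0 -> B_1 -> ... is G: a level-preserving labelling
   of the simple modules by the vertices of G such that the multiplicity of v in
   the restriction of w is 1 if v ↗ w and 0 otherwise. *)
Definition has_branching_diagram (K : fieldType) (B : nat -> algType K)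
    (j : forall n, {lrmorphism B n -> B n.+1})
    d (G : branching_diagram d) : Prop :=
  exists (dim : forall n, G n -> nat)
         (rho : forall n (v : G n), {lrmorphism B n -> 'M[K]_((dim n v).+1)}),
    (forall n, wedderburn_iso (rho n)) /\
    (forall n (w : G n.+1),
       decomposes_with (rho n.+1 w \o j n) (rho n)
                       (fun v => nat_of_bool (bd_up v w))).

(** * Cellular algebras *)

Definition algebra_involution (R : comNzRingType) (A : algType R)
    (star : A -> A) : Prop :=
  [/\ forall (r : R) x y, star (r *: x + y) = r *: star x + star y,
      forall x y, star (x * y) = star y * star x
    & forall x, star (star x) = x].

Section Basis.
Variables (R : nzRingType) (M : lmodType R) (I : choiceType) (b : I -> M).

Definition lincomb (x : {malg R[I]}) : M := \sum_(i <- msupp x) x@_i *: b i.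

Definition is_basis : Prop := bijective lincomb.

Definition span_on (P : I -> Prop) (m : M) : Prop :=
  exists2 x : {malg R[I]}, (forall i, i \in msupp x -> P i) & m = lincomb x.

End Basis.

Definition cell_basis (R : nzRingType) (A : lmodType R) (L : Type)
    (T : L -> choiceType) (c : forall l, T l -> T l -> A)
    (i : {l : L & (T l * T l)%type}) : A :=
  c (tag i) (tagged i).1 (tagged i).2.

(* [cd_r l a s] is the element \sum_v r^s_v(a) c_v of the free module on T l. *)
Record cell_datum (R : idomainType) (A : algType R) (star : A -> A)
    (d : Order.disp_t) (L : porderType d) := CellDatum {
  cd_T : L -> choiceType;
  cd_c : forall l, cd_T l -> cd_T l -> A;
  cd_r : forall l, A -> cd_T l -> {malg R[cd_T l]};
  cd_basis : is_basis (cell_basis cd_c);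
  cd_mul : forall l (a : A) (s t : cd_T l),
    span_on (cell_basis cd_c) (fun i => (l < tag i)%O)
      (a * cd_c s t - \sum_(v <- msupp (cd_r a s)) (cd_r a s)@_v *: cd_c v t);
  cd_involution : algebra_involution star;
  cd_star : forall l (s t : cd_T l),
    span_on (cell_basis cd_c) (fun i => (l < tag i)%O)
      (star (cd_c s t) - cd_c t s)
}.

Section Cellular.
Variables (R : idomainType) (A : algType R) (star : A -> A).
Variables (d : Order.disp_t) (L : porderType d) (C : cell_datum star L).

(* A(U), the span of the c^l_{s,t} with l in U. *)
Definition cell_span (U : L -> Prop) (x : A) : Prop :=
  span_on (cell_basis (@cd_c _ _ _ _ _ C)) (fun i => U (tag i)) x.

Definition cell_ge (l : L) : A -> Prop := cell_span (fun m => (l <= m)%O).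
Definition cell_gt (l : L) : A -> Prop := cell_span (fun m => (l < m)%O).

Definition cell_module (l : L) : lmodType R := {malg R[cd_T C l]}.

Definition cell_act (l : L) (a : A) (x : cell_module l) : cell_module l :=
  lincomb (cd_r (c := C) a) x.

End Cellular.

(** * Towers of algebras *)

Record tower (R : nzRingType) := Tower {
  tw_alg :> nat -> algType R;
  tw_inc : forall n, {lrmorphism tw_alg n -> tw_alg n.+1};
  tw_inj : forall n, injective (tw_inc n)
}.
Arguments tw_inc {R} t {n}.

Fixpoint tw_incn (R : nzRingType) (A : tower R) (k : nat) n (x : A n) :
    A (k + n)%N :=
  if k is k'.+1 then tw_inc A (tw_incn k' x) else x.

Section RestrictionCoherent.
Variables (R : idomainType) (Q : tower R) (star : forall n, Q n -> Q n).
Variables (d : Order.disp_t) (L : nat -> porderType d).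
Variable C : forall n, cell_datum (@star n) (L n).

Definition restricted_submodule n (l : L n.+1)
    (N : cell_module (C n.+1) l -> Prop) : Prop :=
  [/\ N 0, forall x y, N x -> N y -> N (x + y),
      forall (r : R) x, N x -> N (r *: x)
    & forall (a : Q n) x, N x -> N (cell_act (tw_inc Q a) x)].

(* g induces an isomorphism of Q_n-modules from N'/N to the cell module of m. *)
Definition subquotient_iso n (l : L n.+1)
    (N N' : cell_module (C n.+1) l -> Prop) (m : L n)
    (g : cell_module (C n.+1) l -> cell_module (C n) m) : Prop :=
  [/\ forall (r : R) x y, N' x -> N' y -> g (r *: x + y) = r *: g x + g y,
      forall (a : Q n) x, N' x -> g (cell_act (tw_inc Q a) x) = cell_act a (g x),
      forall y, exists2 x, N' x & g x = y
    & forall x, N' x -> (g x = 0 <-> N x)].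

Definition restriction_coherent : Prop :=
  forall n (l : L n.+1),
  exists (t : nat) (N : nat -> cell_module (C n.+1) l -> Prop),
    [/\ forall i, (i <= t)%N -> restricted_submodule (N i),
        forall x, N 0%N x <-> x = 0,
        forall x, N t x,
        forall i x, (i < t)%N -> N i x -> N i.+1 x
      & forall i, (i < t)%N -> exists m g, @subquotient_iso n l (N i) (N i.+1) m g].

End RestrictionCoherent.

(** * Specializations *)

(* A model of the tensor product of A with K over R, for K an R-algebra via phi,
   together with its canonical map a |-> a ⊗ 1, given by the universal property
   of extension of scalars. *)
Record specialization (R : comNzRingType) (K : fieldType)
    (phi : {rmorphism R -> K}) (A : algType R) := Specialization {
  sp_alg :> algType K;
  sp_map : {lrmorphism A -> sp_alg | phi \; *:%R};
  sp_univ : forall (M : lmodType K) (f : {linear A -> M | phi \; *:%R}),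
    exists g : {linear sp_alg -> M},
      (forall a, g (sp_map a) = f a) /\
      (forall g' : {linear sp_alg -> M},
         (forall a, g' (sp_map a) = f a) -> g' =1 g)
}.
Arguments sp_map {R K phi A} s.

Definition specialized_form (R : comNzRingType) (K : fieldType)
    (phi : {rmorphism R -> K}) (A : algType R) (AK : specialization phi A)
    (tau : A -> R) (tauK : {scalar AK}) : Prop :=
  forall a, tauK (sp_map AK a) = phi (tau a).

Definition trace_degenerate (K : fieldType) (A : algType K) (tau : A -> K) :
    Prop :=
  exists2 x, x != 0 & forall y, tau (x * y) = 0.

(** * The framework *)

Definition is_ideal_gen (A : nzRingType) (e x : A) : Prop :=
  exists s : seq (A * A), x = \sum_(p <- s) p.1 * e * p.2.

Record framework (R : idomainType) d (G : branching_diagram d) := Framework {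
  fA : tower R;
  fQ : tower R;
  starA : forall n, fA n -> fA n;
  starQ : forall n, fQ n -> fQ n;
  cellA : forall n, cell_datum (@starA n) (reflected G n);
  cellQ : forall n, cell_datum (@starQ n) (G n);
  delta : R;
  (* [gen n] is e_n for n >= 1; [gen 0] is not used. *)
  gen : forall n, fA n.+1
}.

Section Conditions.
Variables (R : idomainType) (d : Order.disp_t) (G : branching_diagram d).
Variable W : framework R G.

Local Notation A := (fA W).
Local Notation Q := (fQ W).
Local Notation e := (gen W).
Local Notation inc := (tw_inc (fA W)).

(* Any such E k is the conditional expectation from A_{k+1} to A_k: it is unique
   by [commutation_ax] and [injectivity_ax]. *)
Definition cond_exp (E : forall k, A k.+1 -> A k) : Prop :=
  forall k (x : A k.+1),
    let ebar := (delta W)^-1 *: e k.+1 in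
    ebar * inc x * ebar = ebar * inc (inc (E k x)).

Definition tower_trace (tr : forall n, A n -> R) : Prop :=
  exists2 E : forall k, A k.+1 -> A k, cond_exp E &
    (forall r : R, tr 0%N r%:A = r) /\
    (forall k (x : A k.+1), tr k.+1 x = tr k (E k x)).

(* x e_{k+1} e_{k+3} ... e_{k+2s-1} *)
Fixpoint jones_shift (s k : nat) (x : A k) : A (s.*2 + k)%N :=
  if s is s'.+1
  then inc (inc (jones_shift s' x)) * e (s'.*2 + k).+1%N
  else x.

Definition involutions_ax : Prop :=
  [/\ forall n, algebra_involution (@starA _ _ _ W n),
      forall n, algebra_involution (@starQ _ _ _ W n)
    & forall n (x : Q n), starQ (tw_inc Q x) = tw_inc Q (starQ x)].

Definition base_ax : Prop :=
  [/\ bijective (fun r : R => r%:A : A 0%N),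
      bijective (fun r : R => r%:A : Q 0%N)
    & exists f : {lrmorphism A 1%N -> Q 1%N}, bijective f].

Definition coherence_ax : Prop := restriction_coherent (cellQ W).

Definition generic_ax : Prop :=
  [/\ [pchar R] =i pred0,
      forall (QF : forall n, specialization (@FracField.tofrac R) (Q n))
             (j : forall n, {lrmorphism QF n -> QF n.+1}),
        (forall n (a : Q n),
           j n (sp_map (QF n) a) = sp_map (QF n.+1) (tw_inc Q a)) ->
        (forall n, split_semisimple (QF n)) /\ has_branching_diagram j G
    & forall (K : fieldType) (phi : {rmorphism R -> K})
             (QK : forall n, specialization phi (Q n)),
        (forall n, split_semisimple (QK n)) \/
        (exists n1 : nat,
           (forall n, (n <= n1)%N -> split_semisimple (QK n)) /\
           (forall n, (n1 < n)%N -> ~ semisimple (QK n)))].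

Definition idempotent_ax : Prop :=
  delta W \is a GRing.unit /\
  forall n, (1 <= n)%N ->
  [/\ e n * e n = delta W *: e n,
      forall x, is_ideal_gen (e n) x <->
        cell_span (cellA W n.+1) (fun g => (tag (val g) < n.+1)%N) x
    & exists f : {lrmorphism A n.+1 -> Q n.+1},
        (forall y, exists x, f x = y) /\
        (forall x, f x = 0 <-> is_ideal_gen (e n) x)].

Definition temperley_lieb_ax : Prop :=
  [/\ forall n, (1 <= n)%N -> inc (e n) * e n.+1 * inc (e n) = inc (e n),
      forall n, (1 <= n)%N -> e n.+1 * inc (e n) * e n.+1 = e n.+1
    & forall m k, (1 <= m)%N ->
        GRing.comm (e (k.+1 + m.+1)%N) (tw_incn k.+2 (e m))].

Definition commutation_ax : Prop :=
  (forall k (x : A k), GRing.comm (e k.+1) (inc (inc x))) /\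
  (forall k (x : A k.+1), exists y : A k,
     e k.+1 * inc x * e k.+1 = inc (inc y) * e k.+1).

Definition injectivity_ax : Prop :=
  forall n, (1 <= n)%N ->
  (forall x : A n.+1, exists y : A n, x * e n = inc y * e n) /\
  injective (fun x : A n => inc x * e n).

Definition trace_ax (tr : forall n, A n -> R) : Prop :=
  forall n (x y : A n), tr n (x * y) = tr n (y * x).

Definition nondegeneracy_ax (tr : forall n, A n -> R) : Prop :=
  forall (AF : forall n, specialization (@FracField.tofrac R) (A n))
         (trF : forall n, {scalar AF n}),
    (forall n, specialized_form (tr n) (trF n)) ->
    forall n, ~ trace_degenerate (trF n).

(* With n = 2s + k; g and g' are (gamma, k) and (gamma, n). *)
Definition cell_shift_ax : Prop :=
  forall (s k : nat) (g : reflected G k) (g' : reflected G (s.*2 + k)%N),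
    (1 <= s)%N -> val g = val g' ->
    forall x : A k,
      cell_ge (cellA W k) g x -> ~ cell_gt (cellA W k) g x ->
      cell_ge (cellA W (s.*2 + k)%N) g' (jones_shift s x) /\
      ~ cell_gt (cellA W (s.*2 + k)%N) g' (jones_shift s x).

(* That A_n is cellular over level n of the reflected diagram, and Q_n over
   level n of G, is carried by the types of [cellA] and [cellQ]. *)
Definition framework_axioms (tr : forall n, A n -> R) : Prop :=
  (involutions_ax /\ base_ax /\ coherence_ax /\ generic_ax) /\
  (idempotent_ax /\ temperley_lieb_ax /\ commutation_ax /\ injectivity_ax) /\
  (trace_ax tr /\ nondegeneracy_ax tr /\ cell_shift_ax).

End Conditions.

(** * Extended natural numbers: [None] stands for infinity *)

Definition is_least (P : nat -> Prop) (o : option nat) : Prop :=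
  if o is Some n then P n /\ forall k, (k < n)%N -> ~ P k
  else forall k, ~ P k.

Definition le_inf (n : nat) (o : option nat) : bool :=
  if o is Some m then (n <= m)%N else true.

Definition min_inf (o1 o2 : option nat) : option nat :=
  match o1, o2 with
  | Some a, Some b => Some (minn a b)
  | Some a, None => Some a
  | None, _ => o2
  end.

(* Main.v *)
(* Over K, let p be the idempotent delta^-1 e_n of A_{n+1}. The corner
   p A_{n+1} p is a copy of A_{n-1}, so semisimplicity descends two levels at a
   time, and Q_n is a quotient of A_n.

   Let I be the radical of the trace of A_k, where k = n_0. The Markov property
   gives p c x d p in I' p for x in the trace radical of A_m, with p, c, d in
   A_{m+1} and I' the trace radical of A_{m-1}. Hence for 0 <> x in I the left ideal generated
   by x p in A_{k+1} has square zero. If A_{k+2} were semisimple, so would be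
   A_k, hence 1 = f + z with f in I and I z = 0; then E z = 1 and, with q the next
   idempotent, x p z q generates a nonzero left ideal of A_{k+2} of square zero.

   Conversely, if the traces of A_n and A_{n-1} are non-degenerate and A_{n-1}
   is separable, then A_n has finite dual bases u_j, E(v_j .) over A_{n-1}, and
   sum_j u_j p v_j is a unit of the ideal J of A_{n+1} generated by p; the
   involution makes it a two-sided unit. So A_{n+1} is the product of J and
   Q_{n+1}, and a separability idempotent of A_{n-1} provides one of J.
   Separability is used instead of semisimplicity because it passes through this
   step by explicit formulas; it holds for Q_n since Q_n is split. *)

From HB Require Import structures.
From Stdlib Require Import ClassicalEpsilon.
Require Import Defs.
From mathcomp Require Import all_boot all_order all_algebra.
From mathcomp Require Import finmap monalg.

Set Implicit Arguments.
Unset Strict Implicit.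
Unset Printing Implicit Defensive.

Import Order.TTheory GRing.Theory.
Local Open Scope ring_scope.

(** * Choice for dependent families, and linear maps without bundling *)

Lemma functional_choice_of (I : Type) (T : I -> Type)
    (P : forall i, T i -> Prop) :
  (forall i, exists t, P i t) -> exists f : forall i, T i, forall i, P i (f i).
Proof.
move=> ex; exists (fun i => proj1_sig (constructive_indefinite_description _ (ex i))).
by move=> i; apply: proj2_sig.
Qed.

Section Linear.
Variables (R : nzRingType) (U : lmodType R) (V : zmodType).
Variables (s : GRing.Scale.law R V).

Lemma exists_linear (f : U -> V) :
  linear_for s f -> exists g : {linear U -> V | s}, g =1 f.
Proof.
move=> lin_f; pose fL := GRing.isLinear.Build R U V s f lin_f.
by exists (HB.pack_for {linear U -> V | s} f fL).
Qed.

Lemma linear_for_sum (f : U -> V) : linear_for s f ->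
  forall (I : Type) (r : seq I) (P : pred I) (F : I -> U),
    f (\sum_(i <- r | P i) F i) = \sum_(i <- r | P i) f (F i).
Proof.
move=> /exists_linear [g gE] I r P F; rewrite -gE linear_sum.
by apply: eq_bigr => i _; rewrite gE.
Qed.

Lemma linear_for_scale (f : U -> V) : linear_for s f ->
  forall k x, f (k *: x) = s k (f x).
Proof. by move=> /exists_linear [g gE] k x; rewrite -!gE linearZ. Qed.

End Linear.

(** * Separability and complements of left ideals *)

Section SeparableAlgebras.
Variable K : fieldType.

Definition is_bilinear (U V M : lmodType K) (beta : U -> V -> M) : Prop :=
  (forall y, linear (beta^~ y)) /\ (forall x, linear (beta x)).

(* The coordinate functionals need not be dual to the spanning family. *)
Definition finite_dim (V : lmodType K) : Prop :=
  exists (I : finType) (u : I -> V) (f : I -> V -> K),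
    (forall i, scalar (f i)) /\ (forall x, x = \sum_i f i x *: u i).

(* The element [\sum_i s i ⊗ t i] is a separability idempotent; equality in the
   tensor product is tested by bilinear maps. *)
Definition separable (A : algType K) : Prop :=
  exists (I : finType) (s t : I -> A),
    \sum_i s i * t i = 1 /\
    (forall (M : lmodType K) (beta : A -> A -> M), is_bilinear beta ->
       forall a, \sum_i beta (a * s i) (t i) = \sum_i beta (s i) (t i * a)).

(** Starting from zero, a matrix with rows in [P] is enlarged by a vector of [P] outside its row
    space as long as there is one; each enlargement raises the rank, which is at most [n]. *)
Lemma rowspace_of_linear_closed n (P : 'rV[K]_n -> Prop) :
    P 0 -> (forall k u v, P u -> P v -> P (k *: u + v)) ->
  exists M : 'M[K]_n, forall v, P v <-> (v <= M)%MS.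
Proof.
move=> P0 Plin.
have subP (M : 'M[K]_n) v : (forall i, P (row i M)) -> (v <= M)%MS -> P v.
  move=> PM /submxP[D ->]; rewrite mulmx_sum_row.
  by elim/big_rec: _ => // i x _ Px; apply: Plin.
(* [j] bounds the number of enlargements still possible. *)
suff grow j (M : 'M[K]_n) : (n <= \rank M + j)%N -> (forall i, P (row i M)) ->
    exists N : 'M[K]_n, forall v, P v <-> (v <= N)%MS.
  by apply: (grow n 0) => [|i]; rewrite ?leq_addl // row0.
elim: j M => [|j IHj] M le_n PM.
  exists M => v; split=> [_|]; last exact: subP.
  by apply: submx_full; rewrite addn0 in le_n; rewrite /row_full eqn_leq rank_leq_row.
have [[v [Pv nv]]|none] := classic (exists v, P v /\ ~ (v <= M)%MS); last first.
  exists M => v; split; last exact: subP.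
  by move=> Pv; apply: NNPP => nv; apply: none; exists v.
apply: (IHj (M + v)%MS).
  rewrite (leq_trans le_n) // addnS -addSn leq_add2r ltnNge.
  apply/negP=> le; apply: nv; have /mxrank_leqif_sup [_ eqM] := addsmxSl M v.
  have : (M + v <= M)%MS by rewrite -eqM eqn_leq le mxrankS ?addsmxSl.
  by apply: submx_trans; apply: addsmxSr.
move=> i; have /sub_addsmxP[[w1 w2] /= ->] : (row i (M + v)%MS <= M + v)%MS.
  exact: row_sub.
rewrite (mx11_scalar w2) mul_scalar_mx addrC; apply: Plin => //.
by apply: (subP M) => //; apply: submxMl.
Qed.

Lemma finite_dim_ord (V : lmodType K) : finite_dim V ->
  exists (n : nat) (u : 'I_n -> V) (f : V -> 'rV[K]_n),
    linear f /\ (forall x, x = \sum_i f x 0 i *: u i).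
Proof.
case=> I [u [f [lin_f fK]]]; exists #|I|, (u \o enum_val).
exists (fun x => \row_i f (enum_val i) x); split.
  by move=> k x y; apply/rowP=> i; rewrite !mxE lin_f.
move=> x; rewrite {1}(fK x) (reindex _ (onW_bij _ (enum_val_bij I))) /=.
by apply: eq_bigr => i _; rewrite mxE.
Qed.

(** Pulled back to coordinates, [L] is the row space of a matrix [M], and [pinvmx M *m M] fixes
    every vector of that row space and maps into it. *)
Lemma linear_projection (V : lmodType K) (L : V -> Prop) :
    finite_dim V -> L 0 -> (forall k x y, L x -> L y -> L (k *: x + y)) ->
  exists g : {linear V -> V}, (forall x, L (g x)) /\ (forall x, L x -> g x = x).
Proof.
move=> /finite_dim_ord[n [u [f [lin_f fK]]]] L0 Llin.
pose h (v : 'rV[K]_n) := \sum_i v 0 i *: u i.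
have lin_h : linear h.
  move=> k v w; rewrite /h scaler_sumr -big_split /=; apply: eq_bigr => i _.
  by rewrite !mxE scalerDl scalerA.
have [|k v w|M ME] := @rowspace_of_linear_closed n (fun v => L (h v)).
- by rewrite /h big1 // => i _; rewrite mxE scale0r.
- by rewrite lin_h; apply: Llin.
have lin_g : linear (fun x => h (f x *m (pinvmx M *m M))).
  by move=> k x y; rewrite lin_f mulmxDl -scalemxAl lin_h.
have [g gE] := exists_linear lin_g; exists g; split=> x; rewrite gE.
  by apply/ME; rewrite mulmxA submxMl.
move=> Lx; rewrite mulmxA mulmxKpV -?fK //; apply/ME; by rewrite /h -fK.
Qed.

(** As in Maschke's theorem, a [K]-linear projection [g] onto [L] is averaged over the separability
    idempotent; the result [P] is an [A]-linear projection, and its kernel is the complement. *)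
Lemma separable_semisimple (A : algType K) :
  finite_dim A -> separable A -> semisimple A.
Proof.
move=> fdA [I [s [t [st1 sepA]]]] L [L0 LD LM].
have Lsum (J : finType) (F : J -> A) : (forall i, L (F i)) -> L (\sum_i F i).
  by move=> LF; elim/big_rec: _ => // i x _ Lx; apply: LD.
have [|g [Lg gK]] := linear_projection fdA L0.
  by move=> k x y Lx Ly; apply: LD => //; rewrite -[x]mul1r scalerAl; apply: LM.
pose P x := \sum_i s i * g (t i * x).
have LP x : L (P x) by apply: Lsum => i; apply: LM.
have PK x : L x -> P x = x.
  move=> Lx; rewrite -[RHS]mul1r -st1 mulr_suml; apply: eq_bigr => i _.
  by rewrite gK ?mulrA //; apply: LM.
have PM a x : P (a * x) = a * P x.
  have := sepA _ (fun y z => y * g (z * x)) _ a; rewrite /P mulr_sumr => sepa.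
  have {}sepa := sepa _; rewrite -(eq_bigr _ (fun i _ => mulrA a (s i) _)) in sepa.
  rewrite sepa; first by apply: eq_bigr => i _; rewrite mulrA.
  split=> z k y y'; first by rewrite mulrDl scalerAl.
  by rewrite mulrDl -scalerAl linearP mulrDr scalerAr.
have PD x y : P (x + y) = P x + P y.
  by rewrite /P -big_split /=; apply: eq_bigr => i _; rewrite mulrDr raddfD mulrDr.
exists (fun x => P x = 0); split.
- split; first by rewrite PK.
  + by move=> x y Px Py; rewrite PD Px Py addr0.
  + by move=> a x Px; rewrite PM Px mulr0.
- move=> a; exists (P a), (a - P a); split=> //; last by rewrite addrC subrK.
  by apply: (addIr (P a)); rewrite add0r -{2}(PK (P a)) // -PD subrK.
- by move=> x Lx; rewrite PK.
Qed.

End SeparableAlgebras.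

(** * Semisimple rings *)

(** Let L' be a complement of Ax and 1 = ax + y with y in L'. Then x = xax + xy = xy lies both in L'
    and in Ax. *)
Lemma semisimple_semiprime (A : nzRingType) : semisimple A ->
  forall x : A, (forall a, x * a * x = 0) -> x = 0.
Proof.
move=> ssA x xax; have [|L' [idL' L'A dirL]] := ssA (fun y => exists a, y = a * x).
  split; first by exists 0; rewrite mul0r.
  - by move=> _ _ [a ->] [b ->]; exists (a + b); rewrite mulrDl.
  - by move=> b _ [a ->]; exists (b * a); rewrite mulrA.
have [_ [y [[a ->] L'y e1]]] := L'A 1.
have xy : x = x * y by rewrite -{1}[x]mulr1 e1 mulrDr mulrA xax add0r.
apply: dirL; first by exists 1; rewrite mul1r.
by rewrite xy; case: idL' => _ _; apply.
Qed.

Lemma semisimple_quotient (A B : nzRingType) (f : {rmorphism A -> B}) :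
  (forall y, exists x, f x = y) -> semisimple A -> semisimple B.
Proof.
move=> surj_f ssA L [L0 LD LM].
have [|L' [[L'0 L'D L'M] L'A dirL]] := ssA (fun x => L (f x)).
  split; first by rewrite rmorph0.
  - by move=> x y; rewrite rmorphD; apply: LD.
  - by move=> a x; rewrite rmorphM; apply: LM.
exists (fun y => exists2 x, L' x & f x = y); split.
- split; first by exists 0; rewrite ?rmorph0.
  + by move=> _ _ [x Lx <-] [y Ly <-]; exists (x + y); rewrite ?rmorphD //; apply: L'D.
  + move=> b _ [x Lx <-]; have [a <-] := surj_f b.
    by exists (a * x); rewrite ?rmorphM //; apply: L'M.
- move=> b; have [a <-] := surj_f b; have [x [y [Lx Ly ->]]] := L'A a.
  by exists (f x), (f y); split; rewrite ?rmorphD //; exists y.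
- by move=> y Ly [x L'x fx]; rewrite -fx (dirL x) ?rmorph0 ?fx.
Qed.

(** Sending [b] to [i b * p] identifies [B] with the corner pAp. A complement is taken in [A], for a
    left ideal built from [L], and then cut down to the corner. *)
Lemma semisimple_corner (A B : nzRingType) (i : {rmorphism B -> A}) (p : A) :
    p * p = p -> (forall b, GRing.comm p (i b)) ->
    (forall b, i b * p = 0 -> b = 0) ->
    (forall a, exists b, p * a * p = i b * p) ->
  semisimple A -> semisimple B.
Proof.
(* The ideal [C] below is the largest left ideal inside Ap whose left product with [p] stays in the
   copy of [L]. *)
move=> pp pC pI corner ssA L [L0 LD LM].
pose C (x : A) := x * p = x /\ forall a, exists2 b, L b & p * a * x = i b * p.
have [|C' [[C'0 C'D C'M] C'A dirC]] := ssA C.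
  split.
  - split; first by rewrite mul0r.
    by move=> a; exists 0; rewrite ?mulr0 ?rmorph0 ?mul0r.
  - move=> x y [xp Cx] [yp Cy]; split; first by rewrite mulrDl xp yp.
    move=> a; have [b Lb eb] := Cx a; have [c Lc ec] := Cy a.
    by exists (b + c); [apply: LD | rewrite mulrDr rmorphD mulrDl eb ec].
  - move=> a x [xp Cx]; split; first by rewrite -mulrA xp.
    by move=> a'; rewrite mulrA -(mulrA p); apply: Cx.
have CL b : L b -> C (i b * p).
  move=> Lb; split; first by rewrite -mulrA pp.
  move=> a; have [c pap] := corner a; exists (c * b); first exact: LM.
  by rewrite -(pC b) mulrA pap -mulrA pC mulrA rmorphM.
exists (fun b => C' (i b * p)); split.
- split; first by rewrite rmorph0 mul0r.
  + by move=> x y Cx Cy; rewrite rmorphD mulrDl; apply: C'D.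
  + by move=> a x Cx; rewrite rmorphM -mulrA; apply: C'M.
- move=> c; have [x [y [[xp Cx] C'y cp]]] := C'A (i c * p).
  have yp : y * p = y.
    by rewrite -[y](addKr x) -cp mulrDl mulNr xp -mulrA pp.
  have [b Lb px] := Cx 1; have [b' py] := corner y.
  rewrite mulr1 in px; rewrite -mulrA yp in py.
  exists b, b'; split=> //; first by rewrite -py; apply: C'M.
  apply/eqP; rewrite -subr_eq0; apply/eqP; apply: pI.
  by rewrite rmorphB rmorphD mulrBl mulrDl -px -py -mulrDr -cp mulrA pC -mulrA pp subrr.
- by move=> b Lb C'b; apply: pI; apply: dirC => //; apply: CL.
Qed.

(** * Separable algebras *)

Lemma mulmx_delta (R : comNzRingType) m n p (A : 'M[R]_(m, n)) i (j : 'I_p) :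
  A *m delta_mx i j = \sum_k A k i *: delta_mx k j.
Proof.
apply/matrixP=> a b; rewrite mxE summxE (bigD1 i) //= big1 => [|k ki].
  rewrite (bigD1 a) //= big1 => [|k ka]; first by rewrite !mxE !eqxx.
  by rewrite !mxE eq_sym (negPf ka) mulr0.
by rewrite !mxE (negPf ki) mulr0.
Qed.

Lemma delta_mulmx (R : comNzRingType) m n p (A : 'M[R]_(n, p)) (i : 'I_m) j :
  delta_mx i j *m A = \sum_k A j k *: delta_mx i k.
Proof.
apply: trmx_inj; rewrite trmx_mul trmx_delta mulmx_delta linear_sum.
by apply: eq_bigr => k _; rewrite linearZ /= trmx_delta mxE.
Qed.

Lemma sum_tagged (V : nmodType) (I : finType) (J : I -> finType)
    (F : forall i, J i -> V) :
  \sum_(k : {i : I & J i}) F (tag k) (tagged k) = \sum_i \sum_j F i j.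
Proof. by rewrite sig_big_dep. Qed.

Section Bilinear.
Variable K : fieldType.

Lemma bilinear_comp (U V U' V' M : lmodType K) (beta : U -> V -> M)
    (f : U' -> U) (g : V' -> V) :
  is_bilinear beta -> linear f -> linear g ->
  is_bilinear (fun x y => beta (f x) (g y)).
Proof.
move=> [bl br] lin_f lin_g; split=> [y|x] k x1 x2.
  by rewrite lin_f bl.
by rewrite lin_g br.
Qed.

Lemma bilinear_suml (U V M : lmodType K) (beta : U -> V -> M) (I : finType)
    (F : I -> U) y :
  is_bilinear beta -> beta (\sum_i F i) y = \sum_i beta (F i) y.
Proof. by move=> [bl _]; rewrite (linear_for_sum (bl y)). Qed.

Lemma bilinear_sumr (U V M : lmodType K) (beta : U -> V -> M) (I : finType)
    (F : I -> V) x :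
  is_bilinear beta -> beta x (\sum_i F i) = \sum_i beta x (F i).
Proof. by move=> [_ br]; rewrite (linear_for_sum (br x)). Qed.

(** The values of [phi] on a spanning family form a row in the row space of the Gram matrix of
    [tau], and the coefficients of this row give [v]. *)
Lemma nondegenerate_form_represents (A : algType K) (tau : {scalar A})
    (phi : A -> K) :
    finite_dim A -> (forall y, (forall x, tau (x * y) = 0) -> y = 0) ->
  scalar phi -> exists v, forall x, phi x = tau (v * x).
Proof.
move=> /finite_dim_ord[n [u [f [_ fK]]]] nondeg lin_phi.
pose G := \matrix_(i < n, j < n) tau (u i * u j).
pose r := \row_(j < n) phi (u j).
have : (r <= G)%MS.
  rewrite submxE; apply/eqP/rowP=> l; rewrite !mxE.
  (* A column of the cokernel of [G], read as an element of [A], pairs to zero with everything. So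
     it vanishes, and [phi y = 0] is the relation needed for [r]. *)
  pose y := \sum_j (cokermx G) j l *: u j.
  suff y0 : y = 0.
    transitivity (phi y); last first.
      by rewrite y0 -(scale0r 0) (linear_for_scale lin_phi) /= mul0r.
    rewrite (linear_for_sum lin_phi); apply: eq_bigr => j _.
    by rewrite (linear_for_scale lin_phi) /= mxE mulrC.
  apply: nondeg => x; rewrite (fK x) mulr_suml linear_sum big1 // => i _.
  rewrite -scalerAl linearZ /=; suff -> : tau (u i * y) = 0 by rewrite mulr0.
  transitivity ((G *m cokermx G) i l); last by rewrite mulmx_coker mxE.
  rewrite mxE mulr_sumr linear_sum; apply: eq_bigr => j _.
  by rewrite -scalerAr linearZ /= [G i j]mxE mulrC.
case/submxP=> c rE; exists (\sum_i c 0 i *: u i) => x.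
rewrite (fK x) (linear_for_sum lin_phi) mulr_sumr linear_sum.
apply: eq_bigr => j _; rewrite (linear_for_scale lin_phi) -scalerAr linearZ /=.
congr (_ * _); have := congr1 (fun M : 'rV_n => M 0 j) rE; rewrite !mxE => ->.
rewrite mulr_suml linear_sum; apply: eq_bigr => i _.
by rewrite -scalerAl linearZ /= mxE.
Qed.

(* C is the product of the ideal zC, whose coordinates and Casimir element are
   given, with (1 - z)C, which is a copy of a quotient of C / zC. *)
Lemma separable_extension (C Q : algType K) (q : {lrmorphism C -> Q})
    (sec : {linear Q -> C}) (z : C) :
    (forall y, q (sec y) = y) -> (forall a, z * a = a * z) -> z * z = z ->
    (forall x, q x = 0 -> x * z = x) ->
    (exists (I : finType) (u : I -> C) (f : I -> C -> K),
       (forall i, scalar (f i)) /\ (forall x, x * z = \sum_i f i x *: u i)) ->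
    (exists (I : finType) (s t : I -> C), \sum_i s i * t i = z /\
       (forall (M : lmodType K) (beta : C -> C -> M), is_bilinear beta ->
        forall a, \sum_i beta (a * s i) (t i) = \sum_i beta (s i) (t i * a))) ->
    finite_dim Q -> separable Q ->
  finite_dim C /\ separable C.
Proof.
move=> secK zC zz kerz [I [u [f [lin_f fK]]]] [J [s [t [st sep]]]].
move=> [I' [u' [f' [lin_f' fK']]]] [J' [s' [t' [st' sep']]]].
pose w := 1 - z.
have wC a : w * a = a * w by rewrite mulrBl mulrBr mul1r mulr1 zC.
have ww : w * w = w by rewrite {2}/w mulrBr mulr1 mulrBl mul1r zz subrr subr0.
(* The section [sec] is only linear, but [x * w] depends on [q x] alone, so [sec] becomes
   multiplicative after multiplication by [w]. *)
have kerw x y : q x = q y -> x * w = y * w.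
  move=> qxy; apply/eqP; rewrite -subr_eq0 -mulrBl mulrBr mulr1.
  by rewrite kerz ?subrr // rmorphB /= qxy subrr.
split.
  exists (I + I')%type, (fun k => match k with inl i => u i | inr i => sec (u' i) * w end).
  exists (fun k x => match k with inl i => f i x | inr i => f' i (q x) end); split.
    by case=> i k x y; rewrite ?lin_f // linearP lin_f'.
  move=> x; rewrite big_sumType /= -fK.
  transitivity (x * z + x * w); first by rewrite -mulrDr addrC subrK mulr1.
  congr (_ + _); rewrite (kerw x (sec (q x))) // {1}(fK' (q x)).
  rewrite linear_sum mulr_suml.
  by apply: eq_bigr => i _; rewrite linearZ /= scalerAl.
exists (J + J')%type, (fun k => match k with inl i => s i | inr i => w * sec (s' i) end).
exists (fun k => match k with inl i => t i | inr i => sec (t' i) * w end); split.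
  rewrite big_sumType /= st -[RHS](subrK z) addrC; congr (_ + _); rewrite -/w.
  rewrite -{3}[w]mul1r (kerw 1 (\sum_i sec (s' i) * sec (t' i))); last first.
    rewrite rmorph1 rmorph_sum -st'; apply: eq_bigr => i _.
    by rewrite rmorphM /= !secK.
  rewrite mulr_suml; apply: eq_bigr => i _.
  by rewrite wC !mulrA -(mulrA _ w) (wC (sec _)) -!mulrA ww.
move=> M beta bb a; rewrite !big_sumType /= sep //; congr (_ + _).
have e := sep' M (fun x y => beta (w * sec x) (sec y * w)) _ (q a).
have {e}/e e : is_bilinear (fun x y => beta (w * sec x) (sec y * w)).
  apply: (bilinear_comp bb) => k x y; first by rewrite linearP mulrDr -scalerAr.
  by rewrite linearP mulrDl -scalerAl.
have e1 i : a * (w * sec (s' i)) = w * sec (q a * s' i).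
  rewrite mulrA -wC -mulrA !wC; apply: kerw.
  by rewrite rmorphM /= !secK.
have e2 i : sec (t' i) * w * a = sec (t' i * q a) * w.
  rewrite -mulrA wC mulrA; apply: kerw.
  by rewrite rmorphM /= !secK.
rewrite (eq_bigr _ (fun i _ => congr1 (fun x => beta x _) (e1 i))) e.
by apply: eq_bigr => i _; rewrite e2.
Qed.

Lemma separable_scalars (A : algType K) (f : {scalar A}) :
  (forall x, x = (f x)%:A) -> finite_dim A /\ separable A.
Proof.
move=> fK; split.
  exists unit, (fun=> 1), (fun=> f); split=> [_ k x y|x]; first by rewrite linearP.
  by rewrite (big_pred1 tt) => [|[]//]; apply: fK.
exists unit, (fun=> 1), (fun=> 1); split.
  by rewrite (big_pred1 tt) => [|[]//]; rewrite mulr1.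
move=> M beta [bl br] a; rewrite !(big_pred1 tt) => [|[]//|[]//].
by rewrite (fK a) mulr1 mul1r (linear_for_scale (bl _)) (linear_for_scale (br _)).
Qed.

(** With matrix units $E^i_{ab}$ in each block, the separability idempotent is the sum over [i] and
    [a] of $E^i_{a0} ⊗ E^i_{0a}$. *)
Lemma split_semisimple_separable (A : algType K) :
  split_semisimple A -> finite_dim A /\ separable A.
Proof.
case=> I [dim [rho iso]].
pose T := {i : I & ('I_(dim i).+1 * 'I_(dim i).+1)%type}.
have [e eE] : exists e : (forall i, 'M[K]_((dim i).+1)) -> A,
    forall M i, rho i (e M) = M i.
  exists (fun M => proj1_sig (constructive_indefinite_description _ (iso M))).
  move=> M i; by case: constructive_indefinite_description => /= b [].
have rho_inj x y : (forall i, rho i x = rho i y) -> x = y.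
  move=> eqxy; have [b [_ buniq]] := iso (fun i => rho i x).
  by rewrite -(buniq x) ?(buniq y).
(* The component in block [j] is zero unless [i = j], and then the matrix sizes are transported
   along this equality. *)
pose E i (a b : 'I_(dim i).+1) : A := e (fun j =>
  if i =P j is ReflectT ij then castmx (congr1 (fun l => (dim l).+1) ij,
    congr1 (fun l => (dim l).+1) ij) (delta_mx a b) else 0).
have rhoE i a b : rho i (E i a b) = delta_mx a b.
  rewrite eE; case: eqP => // ii; rewrite (eq_axiomK ii) castmx_id //.
have rhoE0 i j a b : i != j -> rho j (E i a b) = 0.
  by rewrite eE; case: eqP.
have coordE x : x = \sum_i \sum_a \sum_b (rho i x) a b *: E i a b.
  apply: rho_inj => j; rewrite linear_sum (bigD1 j) //= [X in _ + X]big1 ?addr0.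
    rewrite {1}[rho j x]matrix_sum_delta !linear_sum; apply: eq_bigr => a _.
    rewrite !linear_sum; apply: eq_bigr => b _; by rewrite linearZ /= rhoE.
  move=> i ij; rewrite linear_sum big1 // => a _; rewrite linear_sum big1 // => b _.
  by rewrite linearZ /= rhoE0 // scaler0.
have mulE x i a c : x * E i a c = \sum_b (rho i x) b a *: E i b c.
  apply: rho_inj => j; rewrite rmorphM linear_sum /=.
  have [<-|ij] := eqVneq i j; last first.
    by rewrite rhoE0 // mulr0 big1 // => b _; rewrite linearZ /= rhoE0 // scaler0.
  rewrite rhoE; under eq_bigr => b _ do rewrite linearZ /= rhoE.
  by rewrite -mulmxE mulmx_delta.
have Emul x i a c : E i c a * x = \sum_b (rho i x) a b *: E i c b.
  apply: rho_inj => j; rewrite rmorphM linear_sum /=.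
  have [<-|ij] := eqVneq i j; last first.
    by rewrite rhoE0 // mul0r big1 // => b _; rewrite linearZ /= rhoE0 // scaler0.
  rewrite rhoE; under eq_bigr => b _ do rewrite linearZ /= rhoE.
  by rewrite -mulmxE delta_mulmx.
split.
  exists {i : I & ('I_(dim i).+1 * 'I_(dim i).+1)%type}.
  exists (fun k => E (tag k) (tagged k).1 (tagged k).2).
  exists (fun k x => rho (tag k) x (tagged k).1 (tagged k).2); split.
    by move=> k c x y; rewrite linearP !mxE.
  move=> x; rewrite {1}(coordE x).
  rewrite (sum_tagged (fun i k => rho i x k.1 k.2 *: E i k.1 k.2)).
  by apply: eq_bigr => i _; rewrite pair_bigA.
exists {i : I & 'I_(dim i).+1}, (fun k => E (tag k) (tagged k) 0).
exists (fun k => E (tag k) 0 (tagged k)); split.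
  rewrite (sum_tagged (fun i a => E i a 0 * E i 0 a)) [RHS]coordE.
  apply: eq_bigr => i _; apply: eq_bigr => a _; rewrite mulE rmorph1.
  apply: eq_bigr => b _; rewrite rhoE !mxE eqxx andbT.
  by have [->|] := eqVneq b a; rewrite ?scale0r.
move=> M beta bb x.
rewrite (sum_tagged (fun i a => beta (x * E i a 0) (E i 0 a))).
rewrite (sum_tagged (fun i a => beta (E i a 0) (E i 0 a * x))).
apply: eq_bigr => i _.
transitivity (\sum_a \sum_b (rho i x) b a *: beta (E i b 0) (E i 0 a)).
  apply: eq_bigr => a _; rewrite mulE bilinear_suml //; apply: eq_bigr => b _.
  by case: bb => bl _; rewrite (linear_for_scale (bl _)).
rewrite exchange_big; apply: eq_bigr => a _; rewrite Emul bilinear_sumr //.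
by apply: eq_bigr => b _; case: bb => _ br; rewrite (linear_for_scale (br _)).
Qed.

End Bilinear.

(** * Ideals generated by an element *)

Lemma is_ideal_gen_mull (B : nzRingType) (e a x : B) :
  is_ideal_gen e x -> is_ideal_gen e (a * x).
Proof.
case=> r ->; exists [seq (a * y.1, y.2) | y <- r].
by rewrite big_map mulr_sumr; apply: eq_bigr => y _; rewrite /= !mulrA.
Qed.

Lemma is_ideal_gen_mulr (B : nzRingType) (e a x : B) :
  is_ideal_gen e x -> is_ideal_gen e (x * a).
Proof.
case=> r ->; exists [seq (y.1, y.2 * a) | y <- r].
by rewrite big_map mulr_suml; apply: eq_bigr => y _; rewrite /= !mulrA.
Qed.

Lemma is_ideal_gen_add (B : nzRingType) (e x y : B) :
  is_ideal_gen e x -> is_ideal_gen e y -> is_ideal_gen e (x + y).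
Proof. by case=> r -> [r' ->]; exists (r ++ r'); rewrite big_cat. Qed.

Lemma is_ideal_gen_self (B : nzRingType) (e : B) : is_ideal_gen e e.
Proof. by exists [:: (1, 1)]; rewrite big_seq1 mul1r mulr1. Qed.

Lemma is_ideal_gen0 (B : nzRingType) (e : B) : is_ideal_gen e 0.
Proof. by exists [::]; rewrite big_nil. Qed.

Lemma is_ideal_gen_sum (B : nzRingType) (e : B) (I : Type) (r : seq I) (P : pred I) F :
  (forall i, is_ideal_gen e (F i)) -> is_ideal_gen e (\sum_(i <- r | P i) F i).
Proof.
move=> eF; elim/big_rec: _ => [|i x _ ex]; first exact: is_ideal_gen0.
exact: is_ideal_gen_add.
Qed.

Lemma is_ideal_gen_image (A B : nzRingType) (f : {rmorphism A -> B}) (e x : A) :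
  is_ideal_gen e x -> is_ideal_gen (f e) (f x).
Proof.
case=> r ->; exists [seq (f y.1, f y.2) | y <- r].
by rewrite big_map rmorph_sum; apply: eq_bigr => y _; rewrite !rmorphM.
Qed.

Lemma is_ideal_gen_unit_scale (R : comUnitRingType) (A : algType R) (u : R)
    (e x : A) :
  u \is a GRing.unit -> is_ideal_gen e x -> is_ideal_gen (u *: e) x.
Proof.
move=> u_unit [r ->]; exists [seq (u^-1 *: y.1, y.2) | y <- r].
rewrite big_map; apply: eq_bigr => y _ /=.
by rewrite -scalerAr -!scalerAl scalerA divrr // scale1r.
Qed.

Lemma is_ideal_gen_linear (R : comNzRingType) (A : algType R) (e : A) k x y :
  is_ideal_gen e x -> is_ideal_gen e y -> is_ideal_gen e (k *: x + y).
Proof.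
move=> ex ey; apply: is_ideal_gen_add => //.
by rewrite -[x]mul1r scalerAl; apply: is_ideal_gen_mull.
Qed.

(** * Towers with Jones idempotents *)

(* [jt_proj n] is the idempotent $\bar e_{n+1}$ of A_{n+2}; [jt_red] extracts
   the coefficient of an element of A_{n+2} $\bar e_{n+1}$ = A_{n+1} $\bar e_{n+1}$. *)
Record jones_tower (R : comUnitRingType) (A : nat -> algType R) := JonesTower {
  jt_inc : forall n, {lrmorphism A n -> A n.+1};
  jt_proj : forall n, A n.+2;
  jt_red : forall n, {linear A n.+2 -> A n.+1};
  jt_exp : forall n, {linear A n.+1 -> A n};
  jt_tr : forall n, {scalar A n};
  jt_index : R;
  jt_index_unit : jt_index \is a GRing.unit;
  jt_scalars : forall x : A 0, x = (jt_tr 0 x)%:A;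
  jt_proj_idem : forall n, jt_proj n * jt_proj n = jt_proj n;
  jt_redK : forall n x, jt_red n (jt_inc n.+1 x * jt_proj n) = x;
  jt_mul_proj : forall n x, x * jt_proj n = jt_inc n.+1 (jt_red n x) * jt_proj n;
  jt_proj_comm : forall n x, GRing.comm (jt_proj n) (jt_inc n.+1 (jt_inc n x));
  jt_proj_exp : forall n x, jt_proj n * jt_inc n.+1 x * jt_proj n =
    jt_inc n.+1 (jt_inc n (jt_exp n x)) * jt_proj n;
  jt_exp_inc : forall n x, jt_exp n (jt_inc n x) = x;
  jt_markov : forall n, jt_exp n.+1 (jt_proj n) = jt_index%:A;
  jt_tr_exp : forall n x, jt_tr n.+1 x = jt_tr n (jt_exp n x);
  jt_trC : forall n x y, jt_tr n (x * y) = jt_tr n (y * x)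
}.

Section JonesTower.
Variables (K : fieldType) (A : nat -> algType K) (T : jones_tower A).

Lemma jt_index_neq0 : jt_index T != 0.
Proof. by rewrite -unitfE jt_index_unit. Qed.

Local Notation p := (jt_proj T).
Local Notation inc := (jt_inc T _).
Local Notation red := (jt_red T _).
Local Notation E := (jt_exp T _).
Local Notation tr := (jt_tr T _).

Definition trace_radical n (x : A n) : Prop := forall y, tr (x * y) = 0.

Lemma jt_inc_inj n : injective (jt_inc T n).
Proof. exact: can_inj (jt_exp_inc T (n:=n)). Qed.

Lemma inc_proj_eq0 n (x : A n.+1) : inc x * p n = 0 -> x = 0.
Proof. by move=> x0; rewrite -(jt_redK T x) x0 linear0. Qed.

Lemma inc2_proj_inj n (x y : A n) :
  inc (inc x) * p n = inc (inc y) * p n -> x = y.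
Proof.
move=> /eqP; rewrite -subr_eq0 -mulrBl -!rmorphB => /eqP/inc_proj_eq0.
by rewrite -[0](rmorph0 (jt_inc T n)) => /jt_inc_inj/eqP; rewrite subr_eq0 => /eqP.
Qed.

(** Both sides are compared as coefficients of [p n], which commutes with [A n]. *)
Lemma exp_mull n (a : A n) (x : A n.+1) : E (inc a * x) = a * E x.
Proof.
apply: inc2_proj_inj; rewrite -jt_proj_exp !rmorphM mulrA jt_proj_comm.
by rewrite -!mulrA (mulrA (p n)) jt_proj_exp.
Qed.

Lemma exp_mulr n (a : A n) (x : A n.+1) : E (x * inc a) = E x * a.
Proof.
apply: inc2_proj_inj; rewrite -jt_proj_exp !rmorphM mulrA -!mulrA -jt_proj_comm.
by rewrite !mulrA jt_proj_exp -!mulrA jt_proj_comm.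
Qed.

(** The Markov property of the trace. *)
Lemma tr_mul_proj n (x : A n.+1) : tr (inc x * p n) = jt_index T * tr x.
Proof. by rewrite jt_tr_exp exp_mull jt_markov -scalerAr mulr1 linearZ. Qed.

Lemma trace_radical_inc n (x : A n) :
  trace_radical x -> trace_radical (jt_inc T n x).
Proof. by move=> x0 y; rewrite jt_tr_exp exp_mull. Qed.

Lemma trace_radical_exp n (x : A n.+1) :
  trace_radical x -> trace_radical (jt_exp T n x).
Proof. by move=> x0 y; rewrite -exp_mulr -jt_tr_exp. Qed.

(** By the Markov property, the pairing of the coefficient [w] with [b] is, up to the invertible
    index, the trace of the product of c, x, d, p, b; cyclicity turns it into a pairing with [x]. *)
Lemma trace_radical_corner n (x : A n.+1) (c d : A n.+2) : trace_radical x ->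
  exists2 w : A n, trace_radical w &
    p n * (c * inc x * d) * p n = inc (inc w) * p n.
Proof.
move=> x0; exists (E (red (c * inc x * d))).
  move=> b; apply: (mulfI jt_index_neq0); rewrite mulr0.
  rewrite -exp_mulr -jt_tr_exp -tr_mul_proj rmorphM -mulrA -jt_proj_comm.
  rewrite mulrA -jt_mul_proj -!mulrA jt_trC -!mulrA.
  by rewrite jt_tr_exp exp_mull x0.
by rewrite -mulrA jt_mul_proj mulrA jt_proj_exp.
Qed.

Lemma trace_radical0 : forall x : A 0, trace_radical x -> x = 0.
Proof. by move=> x /(_ 1); rewrite mulr1 => x0; rewrite (jt_scalars T x) x0 scale0r. Qed.

Lemma semisimple_down2 n : semisimple (A n.+2) -> semisimple (A n).
Proof.
apply: (@semisimple_corner _ _ (jt_inc T n.+1 \o jt_inc T n) (p n)).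
- exact: jt_proj_idem.
- exact: jt_proj_comm.
- by move=> b b0; apply: inc2_proj_inj; rewrite b0 !rmorph0 mul0r.
- move=> a; exists (E (red a)).
  by rewrite -mulrA jt_mul_proj mulrA jt_proj_exp.
Qed.

(** * Degenerate traces obstruct semisimplicity *)

Section DegenerateTrace.
Variables (n : nat) (x : A n.+1).
Hypothesis nondeg : forall y : A n, trace_radical y -> y = 0.
Hypotheses (x0 : x <> 0) (radx : trace_radical x).

(* The left ideal generated by [x p] has square zero. *)
Lemma not_semisimple_next : ~ semisimple (A n.+2).
Proof.
move=> /semisimple_semiprime ss; apply: x0; apply: (@inc_proj_eq0 n).
apply: ss => a; have [w /nondeg -> pw] := trace_radical_corner a 1 radx.
transitivity (inc x * (p n * (a * inc x * 1) * p n)); first by rewrite mulr1 !mulrA.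
by rewrite pw !rmorph0 mul0r mulr0.
Qed.

(* Split 1 = f + z along the trace radical I of A_{n+1}, so that I z = 0 and
   E z = 1; the left ideal generated by [x p z q] has square zero. *)
Lemma not_semisimple_next2 : ~ semisimple (A n.+3).
Proof.
move=> ss3; have ss1 := semisimple_down2 ss3.
have [|L [[L0 LD LM] L'A dirL]] := ss1 (@trace_radical n.+1).
  split=> [y|y z y0 z0 a|a y y0 b]; first by rewrite mul0r linear0.
    by rewrite mulrDl linearD y0 z0 addr0.
  by rewrite -mulrA jt_trC -mulrA y0.
have [f [z [radf Lz fz]]] := L'A 1.
(* The product lies in the radical, which is closed under right multiplication, and in its
   complement [L], which is a left ideal. *)
have radz w : trace_radical w -> w * z = 0.
  by move=> radw; apply: dirL; [move=> y; rewrite -mulrA | apply: LM].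
have Ez : E z = 1.
  have := congr1 (jt_exp T n) fz.
  by rewrite linearD (nondeg (trace_radical_exp radf)) add0r -(rmorph1 inc) jt_exp_inc.
apply: x0; apply: (@inc_proj_eq0 n).
suff xpz : inc x * p n * inc z = 0.
  transitivity (inc x * p n * inc z * p n); last by rewrite xpz mul0r.
  by rewrite -!mulrA (mulrA (p n)) jt_proj_exp Ez !rmorph1 mul1r.
apply: (@inc_proj_eq0 n.+1); apply: (semisimple_semiprime ss3) => a.
(* One level up [x] is still in the trace radical, so the coefficient for the next idempotent is in
   the radical of [A n.+1] and is killed by [z]. *)
have [w radw pw] := trace_radical_corner a (inc (p n)) (trace_radical_inc radx).
transitivity (inc (inc x * p n * inc z) *
    (p n.+1 * (a * inc (inc x) * inc (p n)) * p n.+1) * inc (inc z)).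
  by rewrite !rmorphM -!mulrA jt_proj_comm.
rewrite pw -mulrA -(mulrA (inc (inc w))) jt_proj_comm (mulrA (inc (inc w))).
by rewrite -!rmorphM radz // !rmorph0 mul0r mulr0.
Qed.

End DegenerateTrace.

(** Descent by two levels ends at one of the two levels just above the first degenerate one, and
    both are excluded. The first degenerate level is not 0, since [A 0] consists of scalars. *)
Lemma degenerate_not_semisimple k n :
    is_least (fun m => trace_degenerate (jt_tr T m)) (Some k) -> (k < n)%N ->
  ~ semisimple (A n).
Proof.
case=> -[x /eqP x0 radx] min_k; case: k => [|k] in x x0 radx min_k *.
  by case: (x0 (trace_radical0 radx)).
have nondeg (y : A k) : trace_radical y -> y = 0.
  move=> rady; apply: NNPP => /eqP y0; apply: (min_k k) => //; by exists y.
have [m] := ubnP n; elim: m n => // m IHm [|[|n]] // /ltnSE le_n lt_kn ss.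
have [lt_kn2|] := ltnP k.+1 n.
  by apply: (IHm n) => //; [apply: ltnW | apply: semisimple_down2].
rewrite leq_eqVlt => /predU1P[def_n|lt_nk].
  by subst n; apply: (not_semisimple_next2 nondeg x0 radx ss).
have def_n : n = k by apply: anti_leq; rewrite -ltnS lt_nk; apply: lt_kn.
by subst n; apply: (not_semisimple_next nondeg x0 radx ss).
Qed.

(** * The basic construction for non-degenerate traces *)

Section BasicConstruction.
Variable n : nat.
Hypothesis nondeg0 : forall y : A n, trace_radical y -> y = 0.
Hypothesis nondeg1 : forall y : A n.+1, trace_radical y -> y = 0.
Hypothesis fd1 : finite_dim (A n.+1).
Hypothesis sep0 : separable (A n).

(** Averaging the coordinate functionals [f j] over the separability idempotent of [A n] gives right
    [A n]-linear maps [F j] into [A n]. Composed with the trace they are represented by elements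
    [v j]. *)
Lemma dual_bases : exists (J : finType) (u v : J -> A n.+1),
  forall x, x = \sum_j u j * inc (E (v j * x)).
Proof.
have [J [u [f [lin_f fK]]]] := fd1; have [I [s [t [st1 sep]]]] := sep0.
pose F j x := \sum_i f j (x * inc (s i)) *: t i.
have lin_F j : linear (F j).
  move=> k x y; rewrite /F scaler_sumr -big_split; apply: eq_bigr => i _ /=.
  by rewrite mulrDl -scalerAl lin_f scalerDl scalerA.
have trF j : exists v, forall x, tr (F j x) = tr (v * x).
  apply: nondegenerate_form_represents => //.
    by move=> y y0; apply: nondeg1 => x; rewrite jt_trC.
  by move=> k x y; rewrite lin_F linearP.
have {trF} [v vE] := functional_choice_of trF.
have F_mulr j x b : F j (x * inc b) = F j x * b.
  have := sep (A n) (fun y z => f j (x * inc y) *: z) _ b.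
  rewrite /F mulr_suml => e.
  transitivity (\sum_i f j (x * inc (b * s i)) *: t i).
    by apply: eq_bigr => i _; rewrite rmorphM mulrA.
  rewrite e; first by apply: eq_bigr => i _; rewrite scalerAl.
  split=> [y k y1 y2|y k y1 y2].
    by rewrite linearP mulrDr -scalerAr lin_f scalerDl scalerA.
  by rewrite scalerDr !scalerA mulrC.
(* Both sides have the same trace against every [b] in [A n], where the trace is non-degenerate. *)
have EF j x : E (v j * x) = F j x.
  apply/eqP; rewrite -subr_eq0; apply/eqP; apply: nondeg0 => b.
  rewrite mulrBl linearB /= -exp_mulr -jt_tr_exp -mulrA -vE F_mulr.
  exact: subrr.
exists J, u, v => x.
transitivity (\sum_i x * inc (s i) * inc (t i)).
  rewrite -[LHS]mulr1 -(rmorph1 inc) -st1 rmorph_sum mulr_sumr.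
  by apply: eq_bigr => i _; rewrite rmorphM mulrA.
under [RHS]eq_bigr => j _ do rewrite EF linear_sum mulr_sumr.
rewrite exchange_big; apply: eq_bigr => i _; rewrite {1}(fK (x * inc (s i))).
rewrite mulr_suml; apply: eq_bigr => j _.
by rewrite linearZ /= -scalerAl scalerAr.
Qed.

(** The ideal generated by [p n] acts like matrices over [A n] written in the dual bases, with unit
    [z]; [separable_extension] joins it to [Q]. *)
Lemma basic_construction (Q : algType K) (star : A n.+2 -> A n.+2)
    (q : {lrmorphism A n.+2 -> Q}) (sec : {linear Q -> A n.+2}) :
    (forall x y, star (x * y) = star y * star x) ->
    (forall x y, star (x + y) = star x + star y) -> involutive star ->
    is_ideal_gen (p n) (star (p n)) ->
    (forall y, q (sec y) = y) -> (forall x, q x = 0 -> is_ideal_gen (p n) x) ->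
    finite_dim Q -> separable Q ->
  finite_dim (A n.+2) /\ separable (A n.+2).
Proof.
move=> starM starD starK star_p secK kerq fdQ sepQ.
have [J [u [v uvK]]] := dual_bases.
pose z := \sum_j inc (u j) * p n * inc (v j).
have zJ : is_ideal_gen (p n) z.
  apply: is_ideal_gen_sum => j; apply: is_ideal_gen_mulr; apply: is_ideal_gen_mull.
  exact: is_ideal_gen_self.
have zp c : z * (c * p n) = c * p n.
  rewrite jt_mul_proj mulr_suml {2}(uvK (red c)) rmorph_sum mulr_suml.
  apply: eq_bigr => j _; rewrite rmorphM -!mulrA; congr (_ * _).
  by rewrite (mulrA (inc (v j))) -rmorphM mulrA jt_proj_exp.
have zl x : is_ideal_gen (p n) x -> z * x = x.
  case=> r ->; rewrite mulr_sumr; apply: eq_bigr => c _.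
  by rewrite mulrA zp.
have star0 : star 0 = 0 by apply: (addrI (star 0)); rewrite -starD !addr0.
have starJ x : is_ideal_gen (p n) x -> is_ideal_gen (p n) (star x).
  case=> r ->; rewrite (big_morph star starD star0).
  apply: is_ideal_gen_sum => c; rewrite !starM.
  by apply: is_ideal_gen_mull; apply: is_ideal_gen_mulr.
(* The ideal is stable under [star], which turns the left unit [z] into a right unit; the two then
   coincide. *)
have zr' x : is_ideal_gen (p n) x -> x * star z = x.
  by move=> Jx; apply: (can_inj starK); rewrite starM starK zl //; apply: starJ.
have star_z : star z = z by rewrite -[LHS]zl ?zr' //; apply: starJ.
have zr x : is_ideal_gen (p n) x -> x * z = x by rewrite -star_z; apply: zr'.
apply: (separable_extension secK (z := z)) => //.
- move=> a; transitivity (z * a * z); first by rewrite zr //; apply: is_ideal_gen_mulr.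
  by rewrite -mulrA zl //; apply: is_ideal_gen_mull.
- exact: zl.
- by move=> x /kerq/zr.
(* The terms of [x * z] are $x u_j p v_j$, and $x u_j p$ has a coefficient in [A n.+1], where
   coordinates are available. *)
- have [L [w [f [lin_f fK]]]] := fd1.
  exists (J * L)%type, (fun k => inc (w k.2) * p n * inc (v k.1)).
  exists (fun k x => f k.2 (red (x * inc (u k.1)))); split.
    by move=> k c x y; rewrite mulrDl -scalerAl linearP lin_f.
  move=> x; rewrite -(pair_bigA _ (fun j l => f l (red (x * inc (u j))) *:
    (inc (w l) * p n * inc (v j)))) mulr_sumr; apply: eq_bigr => j _ /=.
  rewrite !mulrA jt_mul_proj {1}(fK (red _)) linear_sum !mulr_suml.
  by apply: eq_bigr => l _; rewrite linearZ /= !scalerAl.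
(* The Casimir element of the ideal is the sum of $u_j p s_i ⊗ t_i p v_j$. *)
have [I [s [t [st1 sep]]]] := sep0.
exists (J * I)%type, (fun k => inc (u k.1) * p n * inc (inc (s k.2))).
exists (fun k => inc (inc (t k.2)) * p n * inc (v k.1)); split.
  rewrite -(pair_bigA _ (fun j i => inc (u j) * p n * inc (inc (s i)) *
    (inc (inc (t i)) * p n * inc (v j)))); apply: eq_bigr => j _ /=.
  transitivity (inc (u j) * p n * inc (inc (\sum_i s i * t i)) * p n * inc (v j)).
    rewrite !rmorph_sum mulr_sumr !mulr_suml; apply: eq_bigr => i _.
    by rewrite !rmorphM !mulrA.
  by rewrite st1 !rmorph1 mulr1 -(mulrA _ (p n) (p n)) jt_proj_idem.
move=> M beta bb a.
(* This is the matrix over [A n] of multiplication by [a]: it acts on the $u_j p$ from the left and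
   on the $p v_k$ from the right. The Casimir identity thus reduces to that of [A n], entry by
   entry. *)
pose b k j := E (red (inc (v k) * a * inc (u j))).
have bE k j : p n * (inc (v k) * a * inc (u j)) * p n = inc (inc (b k j)) * p n.
  by rewrite -mulrA jt_mul_proj mulrA jt_proj_exp.
have aE j : a * (inc (u j) * p n) = \sum_k inc (u k) * p n * inc (inc (b k j)).
  rewrite mulrA -zp mulr_suml; apply: eq_bigr => k _.
  by rewrite -[RHS]mulrA jt_proj_comm -bE !mulrA.
have vE k : p n * inc (v k) * a = \sum_j inc (inc (b k j)) * p n * inc (v j).
  rewrite -[LHS]zr; last first.
    by do 2!apply: is_ideal_gen_mulr; apply: is_ideal_gen_self.
  by rewrite mulr_sumr; apply: eq_bigr => j _; rewrite -bE !mulrA.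
rewrite -(pair_bigA _ (fun j i => beta (a * (inc (u j) * p n * inc (inc (s i))))
  (inc (inc (t i)) * p n * inc (v j)))).
rewrite -(pair_bigA _ (fun j i => beta (inc (u j) * p n * inc (inc (s i)))
  (inc (inc (t i)) * p n * inc (v j) * a))) /=.
have lin_inc2 : linear (fun x : A n => inc (inc x)) by move=> k x y; rewrite !linearP.
transitivity (\sum_j \sum_k \sum_i
    beta (inc (u k) * p n * inc (inc (b k j * s i)))
      (inc (inc (t i)) * p n * inc (v j))).
  apply: eq_bigr => j _; rewrite exchange_big; apply: eq_bigr => i _.
  rewrite mulrA aE mulr_suml bilinear_suml //; apply: eq_bigr => k _.
  by rewrite !rmorphM !mulrA.
rewrite exchange_big; apply: eq_bigr => k _.
transitivity (\sum_j \sum_i beta (inc (u k) * p n * inc (inc (s i)))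
      (inc (inc (t i * b k j)) * p n * inc (v j))).
  apply: eq_bigr => j _.
  apply: (sep M (fun x y => beta (inc (u k) * p n * inc (inc x))
      (inc (inc y) * p n * inc (v j)))).
  apply: (bilinear_comp bb) => c x y; first by rewrite lin_inc2 mulrDr scalerAr.
  by rewrite lin_inc2 !mulrDl !scalerAl.
rewrite exchange_big; apply: eq_bigr => i _.
rewrite -!mulrA (mulrA (p n)) vE mulr_sumr bilinear_sumr //.
by apply: eq_bigr => j _; rewrite !rmorphM -!mulrA.
Qed.

End BasicConstruction.
End JonesTower.

(** * Extension of scalars *)

Definition has_basis (R : nzRingType) (M : lmodType R) : Prop :=
  exists (I : choiceType) (b : I -> M), is_basis b.

Section Lincomb.
Variables (R : nzRingType) (M : lmodType R) (I : choiceType) (b : I -> M).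

Lemma lincombEw (S : {fset I}) (x : {malg R[I]}) :
  (msupp x `<=` S)%fset -> lincomb b x = \sum_(i <- S) x@_i *: b i.
Proof.
move=> sub_xS; apply: big_fset_incl => // i _ /mcoeff_outdom ->.
exact: scale0r.
Qed.

Lemma lincomb_linear : linear (lincomb b).
Proof.
move=> k x y; pose S := (msupp (k *: x + y) `|` (msupp x `|` msupp y))%fset.
have subS : [/\ msupp (k *: x + y) `<=` S, msupp x `<=` S & msupp y `<=` S]%fset.
  split; first exact: fsubsetUl.
    exact: fsubset_trans (fsubsetUl _ _) (fsubsetUr _ _).
  exact: fsubset_trans (fsubsetUr _ _) (fsubsetUr _ _).
case: subS => S1 S2 S3; rewrite (lincombEw S1) (lincombEw S2) (lincombEw S3).
rewrite scaler_sumr -big_split; apply: eq_bigr => i _ /=.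
by rewrite mcoeffD mcoeffZ scalerDl scalerA.
Qed.

Lemma lincombU i : lincomb b << i >> = b i.
Proof.
rewrite (lincombEw (S := [fset i]%fset)) ?msuppU_le // big_seq_fset1.
by rewrite mcoeffUU scale1r.
Qed.

Lemma span_on_linear (P : I -> Prop) k x y :
  span_on b P x -> span_on b P y -> span_on b P (k *: x + y).
Proof.
case=> [c Pc ->] [d Pd ->]; exists (k *: c + d); last by rewrite lincomb_linear.
move=> i /(fsubsetP (msuppD_le _ _)); rewrite in_fsetU => /orP[|/Pd //].
by move=> /(fsubsetP (msuppZ_le _ _))/Pc.
Qed.

Lemma span_on0 (P : I -> Prop) : span_on b P 0.
Proof.
exists 0; first by move=> i; rewrite msupp0.
by rewrite /lincomb msupp0 big_seq_fset0.
Qed.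

Lemma span_on_basis (P : I -> Prop) i : P i -> span_on b P (b i).
Proof.
move=> Pi; exists << i >>; last by rewrite lincombU.
by move=> j /(fsubsetP msuppU_le); rewrite inE => /eqP ->.
Qed.

Lemma span_onS (P P' : I -> Prop) x :
  (forall i, P i -> P' i) -> span_on b P x -> span_on b P' x.
Proof. by move=> PP' [c Pc ->]; exists c => // i /Pc/PP'. Qed.

End Lincomb.

(** Free modules are projective: a preimage is chosen for each basis element. *)
Lemma linear_section (R : nzRingType) (V W : lmodType R) (f : {linear V -> W}) :
    has_basis W -> (forall y, exists x, f x = y) ->
  exists g : {linear W -> V}, forall y, f (g y) = y.
Proof.
case=> I [b [coord coordK lincombK]] surj_f.
have [v fv] := functional_choice_of (fun i => surj_f (b i)).
have lin_coord : linear coord.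
  by move=> k x y; apply: (can_inj coordK); rewrite lincomb_linear !lincombK.
have [k x y|g gE] := @exists_linear _ _ _ *:%R (fun y => lincomb v (coord y)).
  by rewrite lin_coord lincomb_linear.
exists g => y; rewrite gE -{2}(lincombK y) linear_sum; apply: eq_bigr => i _.
by rewrite linearZ fv.
Qed.

Section Specialization.
Variables (R : idomainType) (K : fieldType) (phi : {rmorphism R -> K}).

Lemma specialization_extend (A : algType R) (AK : specialization phi A)
    (M : lmodType K) (f : A -> M) : linear_for (phi \; *:%R) f ->
  exists g : {linear AK -> M}, forall a, g (sp_map AK a) = f a.
Proof.
move=> /exists_linear [f' f'E]; have [g [gE _]] := @sp_univ _ _ _ _ AK _ f'.
by exists g => a; rewrite gE f'E.
Qed.

Lemma specialization_unique (A : algType R) (AK : specialization phi A)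
    (M : lmodType K) (g h : {linear AK -> M}) :
  (forall a, g (sp_map AK a) = h (sp_map AK a)) -> g =1 h.
Proof.
move=> gh; have lin_h : linear_for (phi \; *:%R) (fun a => h (sp_map AK a)).
  by move=> k x y; rewrite !linearP.
have [f fE] := exists_linear lin_h; have [g' [_ g'P]] := @sp_univ _ _ _ _ AK _ f.
by move=> x; rewrite (g'P g) ?(g'P h) // => a; rewrite fE.
Qed.

(* As A is free, the linear combinations of the images of its basis are the
   values of an endomorphism of A^K that extends the canonical map. *)
Lemma specialization_ind (A : algType R) (AK : specialization phi A)
    (P : AK -> Prop) : has_basis A ->
    (forall a, P (sp_map AK a)) ->
    (forall k x y, P x -> P y -> P (k *: x + y)) ->
  forall x, P x.
Proof.
case=> I [b [coord coordK lincombK]] Psp Plin.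
have lin_coord : linear coord.
  by move=> k x y; apply: (can_inj coordK); rewrite lincomb_linear !lincombK.
pose f a : {malg K[I]} := [malg i in msupp (coord a) => phi (coord a)@_i]%fset.
have fE a i : (f a)@_i = phi (coord a)@_i.
  by rewrite mcoeffE; case: msuppP => // _; rewrite rmorph0.
have [k x y|g gE] := @specialization_extend A AK _ f.
  apply/malgP=> i /=.
  by rewrite mcoeffD mcoeffZ !fE lin_coord mcoeffD mcoeffZ rmorphD rmorphM.
pose h := lincomb (fun i => sp_map AK (b i)) : {malg K[I]} -> AK.
have [k x y|e eE] := @exists_linear _ _ _ *:%R (fun x => h (g x)).
  by rewrite linearP /h lincomb_linear.
(* [e] fixes the image of [A], so the uniqueness in the universal property makes it the identity. *)
have eK : e =1 idfun.
  apply: specialization_unique => a /=; rewrite eE gE.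
  rewrite /h (@lincombEw _ _ _ _ (msupp (coord a))).
    rewrite -[in RHS](lincombK a) [in RHS]/lincomb linear_sum.
    by apply: eq_bigr => i _; rewrite linearZ fE.
  apply/fsubsetP=> i; rewrite -mcoeff_neq0 fE -mcoeff_neq0.
  by apply: contraNneq => ->; rewrite rmorph0.
have P0 : P 0 by rewrite -(raddf0 (sp_map AK)); apply: Psp.
move=> x; rewrite -[x]eK eE /h /lincomb.
elim/big_rec: _ => [|i y _ Py]; first exact: P0.
by apply: Plin.
Qed.

Section Maps.
Variables (A B : algType R) (AK : specialization phi A) (BK : specialization phi B).
Hypotheses (freeA : has_basis A) (freeB : has_basis B).

Lemma specialization_linear (f : {linear A -> B}) :
  exists g : {linear AK -> BK}, forall a, g (sp_map AK a) = sp_map BK (f a).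
Proof. by apply: specialization_extend => k x y; rewrite !linearP. Qed.

Lemma specialization_lrmorphism (f : {lrmorphism A -> B}) :
  exists g : {lrmorphism AK -> BK}, forall a, g (sp_map AK a) = sp_map BK (f a).
Proof.
have [g gE] := specialization_linear f.
have gM : monoid_morphism g.
  split; first by rewrite -(rmorph1 (sp_map AK)) gE !rmorph1.
  move=> x y; move: x; apply: (specialization_ind freeA) => [a|k x x' xE x'E].
    move: y; apply: (specialization_ind freeA) => [b|k x x' xE x'E].
      by rewrite -rmorphM !gE !rmorphM.
    by rewrite mulrDr -scalerAr !linearP /= xE x'E mulrDr -scalerAr.
  by rewrite mulrDl -scalerAl !linearP /= xE x'E mulrDl -scalerAl.
pose gL := GRing.isMonoidMorphism.Build AK BK g gM.
by exists (HB.pack_for {lrmorphism AK -> BK} (GRing.Linear.sort g) g gL).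
Qed.

(** As [B] is free, [f] has a linear section, which specializes to [h]. Then [x - h (g x)] lies in
    [N] for [x] in the image of [A], hence for all [x]; it equals [x] when [g x = 0]. *)
Lemma specialization_surjection (f : {lrmorphism A -> B}) (N : AK -> Prop) :
    (forall y, exists x, f x = y) -> (forall a, f a = 0 -> N (sp_map AK a)) ->
    (forall k x y, N x -> N y -> N (k *: x + y)) ->
  exists (g : {lrmorphism AK -> BK}) (h : {linear BK -> AK}),
    (forall y, g (h y) = y) /\ (forall x, g x = 0 -> N x).
Proof.
move=> surj_f kerf Nlin.
have [s sK] := linear_section (f := f) freeB surj_f.
have [g gE] := specialization_lrmorphism f.
have [h hE] : exists h : {linear BK -> AK}, forall b, h (sp_map BK b) = sp_map AK (s b).
  by apply: specialization_extend => k x y; rewrite !linearP.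
exists g, h; split.
  apply: (specialization_ind freeB) => [b|k x y xE yE]; first by rewrite hE gE sK.
  by rewrite !linearP /= xE yE.
suff Nx x : N (x - h (g x)) by move=> x gx; have := Nx x; rewrite gx linear0 subr0.
move: x; apply: (specialization_ind freeA) => [a|k x y Nx Ny].
  by rewrite gE hE -raddfB; apply: kerf; rewrite linearB /= sK subrr.
suff -> : k *: x + y - h (g (k *: x + y)) = k *: (x - h (g x)) + (y - h (g y)).
  exact: Nlin.
by rewrite linearP /= linearP /= opprD addrACA scalerBr.
Qed.

End Maps.

Lemma specialization_star (A : algType R) (AK : specialization phi A)
    (star : A -> A) : has_basis A -> algebra_involution star ->
  exists2 starK : {linear AK -> AK},
    forall a, starK (sp_map AK a) = sp_map AK (star a) &
    (forall x y, starK (x * y) = starK y * starK x) /\ involutive starK.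
Proof.
move=> freeA [starL starM starK].
have [s sE] : exists s : {linear AK -> AK}, forall a, s (sp_map AK a) = sp_map AK (star a).
  by apply: specialization_extend => k x y; rewrite starL !linearP.
exists s => //; split.
  move=> x y; move: x; apply: (specialization_ind freeA) => [a|k x x' xE x'E].
    move: y; apply: (specialization_ind freeA) => [b|k x x' xE x'E].
      by rewrite -rmorphM !sE starM rmorphM.
    by rewrite mulrDr -scalerAr !linearP /= xE x'E mulrDl -scalerAl.
  by rewrite mulrDl -scalerAl !linearP /= xE x'E mulrDr -scalerAr.
apply: (specialization_ind freeA) => [a|k x y xE yE]; first by rewrite !sE starK.
by rewrite !linearP /= xE yE.
Qed.

(** Injectivity need not survive a change of scalars, so the structure records it through the linear
    left inverses [jt_red] and [jt_exp]. Its laws are then identities linear in each variable, to be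
    checked on the images of the [A n]. *)
Lemma specialize_jones_tower (A : nat -> algType R)
    (AK : forall n, specialization phi (A n)) (T : jones_tower A)
    (trK : forall n, {scalar AK n}) :
    (forall n, has_basis (A n)) ->
    (forall n, specialized_form (jt_tr T n) (trK n)) ->
  exists S : jones_tower (fun n => AK n : algType K),
    (forall n, jt_tr S n = trK n) /\
    (forall n, jt_proj S n = sp_map (AK n.+2) (jt_proj T n)).
Proof.
move=> freeA trKE.
have [inc incE] := functional_choice_of (fun n =>
  specialization_lrmorphism (AK n) (AK n.+1) (freeA n) (jt_inc T n)).
have [red redE] := functional_choice_of (fun n =>
  specialization_linear (AK n.+2) (AK n.+1) (jt_red T n)).
have [E EE] := functional_choice_of (fun n =>
  specialization_linear (AK n.+1) (AK n) (jt_exp T n)).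
pose p n := sp_map (AK n.+2) (jt_proj T n).
have ind n (P : AK n -> Prop) := @specialization_ind _ (AK n) P (freeA n).
unshelve refine (ex_intro _ (@JonesTower _ _ inc p red E trK (phi (jt_index T))
  _ _ _ _ _ _ _ _ _ _ _) _) => //=.
- by rewrite rmorph_unit // jt_index_unit.
- apply: ind => [a|k x y xE yE].
    by rewrite {1}(jt_scalars T a) linearZ /= rmorph1 trKE.
  by rewrite linearP scalerDl -scalerA -xE -yE.
- by move=> n; rewrite -rmorphM jt_proj_idem.
- move=> n; apply: ind => [a|k x y xE yE].
    by rewrite incE -rmorphM redE jt_redK.
  by rewrite linearP mulrDl -scalerAl linearP /= xE yE.
- move=> n; apply: ind => [a|k x y xE yE].
    by rewrite redE incE -!rmorphM -jt_mul_proj.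
  by rewrite !linearP /= !mulrDl -!scalerAl xE yE.
- move=> n; apply: ind => [a|k x y xE yE].
    by rewrite !incE /GRing.comm -!rmorphM jt_proj_comm.
  by rewrite /GRing.comm !linearP /= mulrDl mulrDr -scalerAl -scalerAr xE yE.
- move=> n; apply: ind => [a|k x y xE yE].
    by rewrite EE !incE -!rmorphM jt_proj_exp.
  by rewrite !linearP /= mulrDr !mulrDl -scalerAr -!scalerAl xE yE.
- move=> n; apply: ind => [a|k x y xE yE]; first by rewrite incE EE jt_exp_inc.
  by rewrite !linearP /= xE yE.
- by move=> n; rewrite EE jt_markov linearZ /= rmorph1.
- move=> n; apply: ind => [a|k x y xE yE]; first by rewrite EE !trKE jt_tr_exp.
  by rewrite !linearP /= xE yE.
move=> n x y; move: x; apply: (ind n) => [a|k x x' xE x'E].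
  move: y; apply: (ind n) => [b|k x x' xE x'E]; first by rewrite -!rmorphM !trKE jt_trC.
  by rewrite mulrDr mulrDl -scalerAr -scalerAl !linearP /= xE x'E.
by rewrite mulrDl mulrDr -scalerAl -scalerAr !linearP /= xE x'E.
Qed.

End Specialization.

(** * The framework *)

Section CellularAlgebras.
Variables (R : idomainType) (A : algType R) (star : A -> A).
Variables (d : Order.disp_t) (L : porderType d) (C : cell_datum star L).

Lemma cellular_has_basis : has_basis A.
Proof. by eexists; eexists; apply: cd_basis C. Qed.

(** The involution only swaps the two indices of a basis element, up to terms in strictly higher
    cells, which still belong to [U]. *)
Lemma cell_span_star (U : L -> Prop) : (forall l m, U l -> (l < m)%O -> U m) ->
  forall x, cell_span C U x -> cell_span C U (star x).
Proof.
move=> upU x [c Uc ->]; have [starL _ _] := cd_involution C.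
rewrite (linear_for_sum (s := *:%R) starL) big_seq.
elim/big_rec: _ => [|[l [s t]] y /Uc /= Ul Uy]; first exact: span_on0.
rewrite (linear_for_scale (s := *:%R) starL) /=.
apply: span_on_linear => //; rewrite /cell_basis /=.
rewrite -[star _](subrK (cd_c (c := C) t s)) -[X in X + _]scale1r.
apply: span_on_linear.
  by apply: (span_onS _ (cd_star s t)) => i; apply: upU.
exact: (@span_on_basis _ _ _ _ _ (existT _ l (t, s))).
Qed.

End CellularAlgebras.

Section Framework.
Variables (R : idomainType) (d : Order.disp_t) (G : branching_diagram d).
Variables (W : framework R G) (tr : forall n, fA W n -> R).
Hypotheses (htr : tower_trace tr) (hW : framework_axioms tr).

Local Notation inc := (tw_inc (fA W)).
Local Notation e := (gen W).

(** Right multiplication by the idempotent is injective on the previous level; this makes the chosen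
    coefficient maps [red] and [E] linear. *)
Lemma framework_jones_tower : exists T : jones_tower (fA W),
  (forall n x, jt_tr T n x = tr x) /\
  (forall n, jt_proj T n = (delta W)^-1 *: e n.+1).
Proof.
have [E EE [tr0 trS]] := htr.
have [[_ [[[r r1 r2] _ _] _]] [[[delta_unit idem] [[_ tl _] [[comm _] inj]]] [trC _]]] := hW.
pose u := (delta W)^-1; have uK : u * delta W = 1 by rewrite mulVr.
have [p pdef] : exists p : forall n, fA W n.+2, forall n, p n = u *: e n.+1.
  by exists (fun n => u *: e n.+1).
have eE n : e n.+1 = delta W *: p n by rewrite pdef scalerA mulrC uK scale1r.
have pp n : p n * p n = p n.
  rewrite pdef -scalerAl -scalerAr; have [-> _ _] := idem n.+1 isT.
  by rewrite !scalerA -mulrA uK mulr1.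
have p_inj n (x y : fA W n.+1) : inc x * p n = inc y * p n -> x = y.
  move=> xy; have [_] := inj n.+1 isT; apply.
  by rewrite /= eE -!scalerAr xy.
have p_inj2 n (x y : fA W n) : inc (inc x) * p n = inc (inc y) * p n -> x = y.
  by move=> /p_inj; apply: tw_inj.
have pC n (x : fA W n) : GRing.comm (p n) (inc (inc x)).
  by rewrite /GRing.comm pdef -scalerAl comm scalerAr.
have pE n (x : fA W n.+1) : p n * inc x * p n = inc (inc (E n x)) * p n.
  by rewrite -pC !pdef; apply: EE.
have exR n (c : fA W n.+2) : exists y, c * p n = inc y * p n.
  have [ex _] := inj n.+1 isT; have [y cy] := ex c.
  by exists y; rewrite pdef -!scalerAr cy.
have [red redE] := functional_choice_of (fun n => functional_choice_of (@exR n)).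
have lin_red n : linear (red n).
  move=> k x y; apply: p_inj; rewrite linearP !mulrDl -!scalerAl.
  by rewrite -!redE mulrDl -scalerAl.
have lin_E n : linear (E n).
  move=> k x y; apply: p_inj2; rewrite -pE !linearP mulrDr !mulrDl.
  by rewrite -scalerAr -!scalerAl !pE.
have E1 n (x : fA W n) : E n (inc x) = x.
  by apply: p_inj2; rewrite -pE pC -mulrA pp.
have lin_tr n : scalar (@tr n).
  elim: n => [|n IHn] k x y; last by rewrite !trS lin_E IHn.
  by rewrite -(r2 x) -(r2 y) scalerA -scalerDl !tr0.
(* In $e_{n+2} e_{n+1} e_{n+2} = e_{n+2}$ normalization brings three factors [u], one of which is
   absorbed by [p n.+1]; the index is thus $\delta^{-2}$. *)
have markov n : E n.+1 (p n) = (u * u)%:A.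
  apply: p_inj2; rewrite -pE; transitivity ((u * u) *: p n.+1).
    by rewrite !pdef linearZ /= -!scalerAr -!scalerAl tl // !scalerA mulrA.
  by rewrite !linearZ /= !rmorph1 -scalerAl mul1r.
have [red' red'E] := functional_choice_of (fun n => exists_linear (@lin_red n)).
have [E' E'E] := functional_choice_of (fun n => exists_linear (@lin_E n)).
have [tr' tr'E] := functional_choice_of (fun n => exists_linear (@lin_tr n)).
unshelve refine (ex_intro _ (@JonesTower _ _ (fun n => @tw_inc _ (fA W) n) p
  red' E' tr' (u * u) _ _ _ _ _ _ _ _ _ _ _) _) => //=.
- by rewrite unitrM unitrV delta_unit.
- by move=> x; rewrite tr'E -(r2 x) tr0.
- by move=> n x; apply: p_inj; rewrite red'E -redE -mulrA pp.
- by move=> n x; rewrite red'E -redE.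
- by move=> n x; rewrite E'E pE.
- by move=> n x; rewrite E'E E1.
- by move=> n; rewrite E'E markov.
- by move=> n x; rewrite !tr'E E'E trS.
- by move=> n x y; rewrite !tr'E trC.
Qed.

Lemma framework_basisA n : has_basis (fA W n).
Proof. exact: cellular_has_basis (cellA W n). Qed.

Lemma framework_basisQ n : has_basis (fQ W n).
Proof. exact: cellular_has_basis (cellQ W n). Qed.

(** The ideal is spanned by the cells with |v| < n + 2. Going up in the reflected order never raises
    |v|, so this span is stable under the involution. *)
Lemma gen_star n : is_ideal_gen (e n.+1) (starA (e n.+1)).
Proof.
have [_ [[[_ idem] _] _]] := hW; have [_ idealE _] := idem n.+1 isT.
apply/idealE; apply: cell_span_star; last exact/idealE/is_ideal_gen_self.
move=> l m /= ltl /ltW; rewrite /Order.le /= /reflected_le.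
case/orP=> [|/andP[/eqP <- _] //].
by move=> lt_ml; apply: ltn_trans lt_ml ltl.
Qed.

End Framework.

(** * The semisimplicity criterion over [K] *)

Lemma le_min_inf n o1 o2 : le_inf n (min_inf o1 o2) = le_inf n o1 && le_inf n o2.
Proof. by case: o1 o2 => [a|] [b|] //=; rewrite ?leq_min ?andbT. Qed.

Theorem theorem3p11 (R : idomainType) (d : Order.disp_t)
    (G : branching_diagram d) (W : framework R G)
    (tr : forall n, fA W n -> R)
    (hG : infinite_diagram G)
    (htr : tower_trace tr)
    (hW : framework_axioms tr)
    (K : fieldType) (phi : {rmorphism R -> K})
    (AK : forall n, specialization phi (fA W n))
    (QK : forall n, specialization phi (fQ W n))
    (trK : forall n, {scalar AK n})
    (htrK : forall n, specialized_form (tr n) (trK n))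
    (n0 n1 : option nat)
    (hn0 : is_least (fun n => trace_degenerate (trK n)) n0)
    (hn1 : is_least (fun n => ~ semisimple (QK n)) (omap succn n1)) :
  forall n, semisimple (AK n) <-> le_inf n (min_inf n0 n1).
Proof.
have [T [trT projT]] := framework_jones_tower htr hW.
have [S [trS projS]] : exists S : jones_tower (fun n => AK n : algType K),
    (forall n, jt_tr S n = trK n) /\
    (forall n, jt_proj S n = sp_map (AK n.+2) (jt_proj T n)).
  apply: specialize_jones_tower => [n|n a]; first exact: framework_basisA.
  by rewrite htrK trT.
have [[[invA _ _] [[_ _ [f1 f1_bij]] [_ [_ _ split_or]]]]
  [[[delta_unit idem] _] _]] := hW.
(* [J n] is to contain the kernel of the map from level [n.+1] of A to that of Q; it is zero at
   level 1, where the two algebras are isomorphic. *)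
pose J n : AK n.+1 -> Prop :=
  if n is m.+1 then is_ideal_gen (jt_proj S m) else fun x => x = 0.
have ideal_sp n a : is_ideal_gen (gen W n.+1) a ->
    is_ideal_gen (jt_proj S n) (sp_map (AK n.+2) a).
  move=> ea; rewrite projS projT; apply: is_ideal_gen_image.
  by apply: is_ideal_gen_unit_scale => //; rewrite unitrV.
have quot n : exists (q : {lrmorphism AK n.+1 -> QK n.+1})
    (sec : {linear QK n.+1 -> AK n.+1}),
    (forall y, q (sec y) = y) /\ (forall x, q x = 0 -> J n x).
  have [bA bQ] := (framework_basisA W n.+1, framework_basisQ W n.+1).
  case: n bA bQ => [|n] bA bQ.
    apply: (@specialization_surjection _ _ _ _ _ (AK 1%N) (QK 1%N) bA bQ f1
      (J 0%N)) => [y|a|k x y].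
    - by have [g _ gK] := f1_bij; exists (g y).
    - by rewrite -(rmorph0 f1) => /(bij_inj f1_bij) ->; rewrite /= raddf0.
    - by rewrite /= => -> ->; rewrite scaler0 addr0.
  have [_ _ [f [surj_f kerf]]] := idem n.+1 isT.
  apply: (@specialization_surjection _ _ _ _ _ (AK n.+2) (QK n.+2) bA bQ f
    (J n.+1) surj_f) => [a /kerf/ideal_sp //|k x y].
  exact: is_ideal_gen_linear.
have ssQ n : split_semisimple (QK n) -> semisimple (QK n).
  by move=> /split_semisimple_separable[]; apply: separable_semisimple.
(* When the axiom supplies a finite threshold [c], minimality forces it to agree with [n1]. *)
have [splitQ nssQ] : (forall n, le_inf n n1 -> split_semisimple (QK n)) /\
    (forall n, ~~ le_inf n n1 -> ~ semisimple (QK n)).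
  have [all_split|[c [split_c nss_c]]] := split_or K phi QK.
    split=> // n; case: n1 hn1 => //= k [nss _] _ _.
    by apply: nss; apply: ssQ.
  case: n1 hn1 => [k|] /= => [[nss ss]|ss]; last first.
    by case: (ss c.+1); apply: nss_c.
  have lt_ck : (c < k.+1)%N.
    by rewrite ltnNge; apply/negP=> /split_c/ssQ.
  split=> n; first last.
    by rewrite -ltnNge => lt_kn; apply: nss_c; apply: leq_ltn_trans lt_kn.
  move=> le_nk; apply: split_c; rewrite leqNgt; apply/negP=> /nss_c.
  exact: ss.
(* Non-degeneracy holds strictly below [n0]. Level [n0] itself is still reached, because the step to
   level [n.+2] uses only the traces of levels [n] and [n.+1]. *)
have nondeg n : le_inf n.+1 n0 ->
    forall x : AK n, trace_radical S x -> x = 0.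
  move=> le_n x radx; apply: NNPP => /eqP x0.
  have deg : trace_degenerate (trK n) by exists x => // y; rewrite -trS.
  by case: n0 hn0 le_n => [k [_ min_k] /min_k|no _]; [|apply: (no n)].
have le_infS n o : le_inf n.+1 o -> le_inf n o.
  by case: o => //= k; apply: ltnW.
have sepA n : le_inf n n0 -> le_inf n n1 ->
    finite_dim (AK n) /\ separable (AK n).
  (* The induction carries two consecutive levels, as the basic construction starts from both. *)
  suff [] : (le_inf n n0 -> le_inf n n1 -> finite_dim (AK n) /\ separable (AK n)) /\
    (le_inf n.+1 n0 -> le_inf n.+1 n1 ->
       finite_dim (AK n.+1) /\ separable (AK n.+1)) by [].
  elim: n => [|n [IHn IHn1]]; split.
  - by move=> _ _; apply: (separable_scalars (jt_scalars S)).
  - move=> _ /splitQ/split_semisimple_separable[fdQ sepQ].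
    have [q [sec [secK kerq]]] := quot 0%N.
    (* At level 1 the ideal is zero: its unit is 0, and its coordinates and Casimir element are
       empty families. *)
    apply: (separable_extension secK (z := 0)) => //.
    + by move=> a; rewrite mul0r mulr0.
    + by rewrite mul0r.
    + by move=> x /kerq ->; rewrite mul0r.
    + exists void, (of_void _), (of_void _); split; first by case.
      by move=> x; rewrite big_pred0 ?mulr0 //; case.
    + exists void, (of_void _), (of_void _); split; first by rewrite big_pred0 //; case.
      by move=> M beta _ a; rewrite !big_pred0 //; case.
  - exact: IHn1.
  - move=> le0 le1; have [q [sec [secK kerq]]] := quot n.+1.
    have [fdQ sepQ] := split_semisimple_separable (splitQ _ le1).
    have [starK starKE [starM starKK]] :=
      specialization_star (AK n.+2) (framework_basisA W n.+2) (invA n.+2).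
    have [fd1 _] := IHn1 (le_infS _ _ le0) (le_infS _ _ le1).
    have [_ sep0] := IHn (le_infS _ _ (le_infS _ _ le0)) (le_infS _ _ (le_infS _ _ le1)).
    apply: (@basic_construction _ _ S n (nondeg n (le_infS _ _ le0))
      (nondeg n.+1 le0) fd1 sep0 _ starK q sec) => //.
      by move=> x y; rewrite linearD.
    rewrite {2}projS starKE projT; have [starL _ _] := invA n.+2.
    rewrite (linear_for_scale (s := *:%R) starL) linearZ /=.
    rewrite -[_ *: _]addr0; apply: is_ideal_gen_linear; last exact: is_ideal_gen0.
    by apply: ideal_sp; apply: gen_star hW n.
move=> n; rewrite le_min_inf; split=> [ss|/andP[le0 le1]]; last first.
  by have [] := sepA n le0 le1; apply: separable_semisimple.
apply/andP; split; apply/negPn/negP=> not_le.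
  case: n0 hn0 not_le {nondeg sepA} => //= k [degk min_k]; rewrite -ltnNge => lt_kn.
  apply: (@degenerate_not_semisimple _ _ S k n) ss => //.
  by split; rewrite ?trS // => j /min_k; rewrite trS.
(* Beyond [n1] the quotient $Q_n^K$ is not semisimple; level 0 never exceeds [n1]. *)
case: n ss not_le => [|n] ss not_le.
  by case: n1 not_le {hn1 splitQ nssQ sepA}.
have [q [sec [secK _]]] := quot n; apply: (nssQ _ not_le).
by apply: (@semisimple_quotient _ _ q _ ss) => y; exists (sec y); apply: secK.
Qed.
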